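(* Let $\Omega$ be a bounded domain of $\mathbb{R}^n$, $n\ge 1$, let $0<\sigma_0<\sigma_1$ be constants, and let $\Sigma=\{\sigma\in L^\infty(\Omega):\ \sigma_0\le\sigma\le\sigma_1 \text{ a.e. in }\Omega\}$. For any $\sigma,\widetilde{\sigma}\in\Sigma$, $$\sigma_0^2\,\|R_\sigma-R_{\widetilde{\sigma}}\|_{-1,1}\le \|\sigma-\widetilde{\sigma}\|_{L^\infty(\Omega)}\le \sigma_1^2\,\|R_\sigma-R_{\widetilde{\sigma}}\|_{-1,1}.$$
   Context: $H_0^1(\Omega)$ is endowed with the norm $\|w\|_{H_0^1(\Omega)}=\|\nabla w\|_{L^2(\Omega)^n}$, and $H^{-1}(\Omega)$ is its dual with the dual norm; $\langle\cdot,\cdot\rangle_{-1,1}$ is the duality pairing between $H^{-1}(\Omega)$ and $H_0^1(\Omega)$. Functions are real-valued. For $\sigma\in\Sigma$, the operator $A_\sigma:H_0^1(\Omega)\to H^{-1}(\Omega)$, $A_\sigma u=-\mathrm{div}(\sigma\nabla u)$, has inverse (resolvent) $R_\sigma:H^{-1}(\Omega)\to H_0^1(\Omega)$; that is, for $f\in H^{-1}(\Omega)$, $R_\sigma f=u_\sigma$ is the unique element of $H_0^1(\Omega)$ with $\int_\Omega\sigma\nabla u_\sigma\cdot\nabla v\,dx=\langle f,v\rangle_{-1,1}$ for all $v\in H_0^1(\Omega)$. $\|\cdot\|_{-1,1}$ denotes the operator norm in $\mathscr{B}(H^{-1}(\Omega),H_0^1(\Omega))$, the space of bounded linear operators. 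*)

(* Defs.v *)
From HB Require Import structures.
From mathcomp Require Import all_boot all_order all_algebra.
From mathcomp Require Import all_classical all_reals all_analysis.

Set Implicit Arguments.
Unset Strict Implicit.
Unset Printing Implicit Defensive.

Import Order.TTheory GRing.Theory Num.Theory.
Import numFieldNormedType.Exports.

Local Open Scope classical_set_scope.
Local Open Scope ring_scope.

Definition rV_display : measure_display -> measure_display.
Proof. exact. Qed.

(* 'rV[R]_n carries the sigma-algebra generated by the n coordinates, as
   n.-tuple R does in the library; it is the Borel sigma-algebra of R^n. *)
Section rV_measurable.
Context {R : realType} (n : nat).

Definition rV_coord (i : 'I_n) (x : 'rV[R]_n) : measurableTypeR R := x 0 i.

Let rV_set0 : g_sigma_preimage rV_coord set0.
Proof. exact: sigma_algebra0. Qed.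

Let rV_setC A : g_sigma_preimage rV_coord A -> g_sigma_preimage rV_coord (~` A).
Proof. exact: sigma_algebraC. Qed.

Let rV_bigcup (F : _^nat) : (forall i, g_sigma_preimage rV_coord (F i)) ->
  g_sigma_preimage rV_coord (\bigcup_i (F i)).
Proof. exact: sigma_algebra_bigcup. Qed.

HB.instance Definition _ := @isMeasurable.Build (rV_display default_measure_display)
  'rV[R]_n (g_sigma_preimage rV_coord) rV_set0 rV_setC rV_bigcup.

End rV_measurable.

Lemma measurable_rV_coord {R : realType} n (i : 'I_n) :
  measurable_fun [set: 'rV[R]_n] (rV_coord i).
Proof.
move=> _ Y mY; rewrite setTI; apply: sub_sigma_algebra => /=.
rewrite -bigcup_seq/=; exists i => /=; first by rewrite mem_index_enum.
by exists Y => //; rewrite setTI.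
Qed.

Lemma measurable_fun_rVP {R : realType} d (T : measurableType d) n
    (f : T -> 'rV[R]_n) :
  (forall i, measurable_fun [set: T] (rV_coord i \o f)) ->
  measurable_fun [set: T] f.
Proof.
move=> mf.
have fS : g_sigma_preimage (fun i => rV_coord i \o f) `<=` measurable.
  apply: smallest_sub; first exact: sigma_algebra_measurable.
  case: n => [|n] in f mf *; first by rewrite big_ord0.
  rewrite -bigcup_mkord_ord; apply: bigcup_sub => i Ii.
  by move=> A [B mB <-]; exact: mf.
move: fS; rewrite g_sigma_preimage_comp => fS _ A mA.
by apply: fS; exists A.
Qed.

(* Puts p.1 in front of the row vector p.2. *)
Definition rV_cons {R : realType} n (p : measurableTypeR R * 'rV[R]_n) :
    'rV[R]_n.+1 :=
  \row_(i < n.+1) (if unlift ord0 i is Some j then p.2 0 j else p.1).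

Definition rV_uncons {R : realType} n (x : 'rV[R]_n.+1) :
    measurableTypeR R * 'rV[R]_n :=
  (x 0 ord0, \row_(j < n) x 0 (lift ord0 j)).

Lemma rV_unconsK {R : realType} n : cancel (@rV_uncons R n) (@rV_cons R n).
Proof.
move=> x; apply/rowP => i; rewrite mxE /=.
by case: unliftP => [j ->|->//]; rewrite mxE.
Qed.

Lemma rV_consK {R : realType} n : cancel (@rV_cons R n) (@rV_uncons R n).
Proof.
move=> [a x]; rewrite /rV_uncons mxE unlift_none; congr pair.
by apply/rowP => j; rewrite !mxE liftK.
Qed.

Lemma measurable_rV_cons {R : realType} n :
  measurable_fun [set: measurableTypeR R * 'rV[R]_n] (@rV_cons R n).
Proof.
apply: measurable_fun_rVP => i.
case: (unliftP ord0 i) => [j ->|->].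
  rewrite (_ : _ \o _ = rV_coord j \o snd).
    by apply: measurableT_comp => //; exact: measurable_rV_coord.
  by apply/funext => p /=; rewrite /rV_coord mxE liftK.
rewrite (_ : _ \o _ = fst) //.
by apply/funext => p /=; rewrite /rV_coord mxE unlift_none.
Qed.

Lemma measurable_rV_uncons {R : realType} n :
  measurable_fun [set: 'rV[R]_n.+1] (@rV_uncons R n).
Proof.
apply: measurable_fun_pair; first exact: (measurable_rV_coord ord0).
apply: measurable_fun_rVP => i.
rewrite (_ : _ \o _ = rV_coord (lift ord0 i)); first exact: measurable_rV_coord.
by apply/funext => x /=; rewrite /rV_coord mxE.
Qed.

Section lebesgue_rV_succ.
Context {R : realType} (n : nat).
Variable mu : {sigma_finite_measure set 'rV[R]_n -> \bar R}.

Definition lebesgue_rV_succ : set 'rV[R]_n.+1 -> \bar R :=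
  pushforward (lebesgue_measure \x mu)%E (@rV_cons R n).

HB.instance Definition _ := Measure.copy lebesgue_rV_succ
  (measure_function_pushforward__canonical__measure_function_Measure
    (lebesgue_measure \x mu)%E (@measurable_rV_cons R n)).

Let lebesgue_rV_succ_sigma_finite : sigma_finite setT lebesgue_rV_succ.
Proof.
have /sigma_finiteP[F [TF ndF Foo]] := sigma_finiteT (@lebesgue_measure R).
have /sigma_finiteP[G [TG ndG Goo]] := sigma_finiteT mu.
exists (fun k => @rV_uncons R n @^-1` (F k `*` G k)).
  rewrite -preimage_bigcup; apply/esym/seteqP; split => // x _ /=.
  have : [set: measurableTypeR R] (rV_uncons x).1 by [].
  have : [set: 'rV[R]_n] (rV_uncons x).2 by [].
  rewrite {1}TF {1}TG => -[k _ Gk] [l _ Fl]; exists (maxn k l) => //; split.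
    by move: Fl; exact/subsetPset/ndF/leq_maxr.
  by move: Gk; exact/subsetPset/ndG/leq_maxl.
move=> k; have [mF Fk] := Foo k; have [mG Gk] := Goo k; split.
  rewrite -[X in measurable X]setTI; apply: measurable_rV_uncons => //.
  exact: measurableX.
rewrite /lebesgue_rV_succ /pushforward -comp_preimage.
rewrite (_ : _ \o _ = idfun); last by apply/funext => p; exact: rV_consK.
by rewrite preimage_id product_measure1E// lte_mul_pinfty// ge0_fin_numE.
Qed.

HB.instance Definition _ := Measure_isSigmaFinite.Build _ _ _ lebesgue_rV_succ
  lebesgue_rV_succ_sigma_finite.

End lebesgue_rV_succ.

Fixpoint lebesgue_rV {R : realType} (n : nat) :
    {sigma_finite_measure set 'rV[R]_n -> \bar R} :=
  match n with
  | 0 => \d_(0 : 'rV[R]_0)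
  | n'.+1 => lebesgue_rV_succ (lebesgue_rV n')
  end.

(* A Sobolev function w is given by a representative w.1 of its class together
   with a representative w.2 of its weak gradient. *)
Notation sobolev_pair R n :=
  (('rV[R]_n -> R) * ('rV[R]_n -> 'rV[R]_n))%type.

Section sobolev.
Context {R : realType} {n : nat}.
Implicit Types (Omega : set 'rV[R]_n) (a b : 'rV[R]_n).

Local Notation mu := (lebesgue_rV n).

(* The norm of 'rV[R]_n in the library is the sup norm, so the Euclidean
   structure is spelled out. *)
Definition dotr a b : R := \sum_(i < n) a 0 i * b 0 i.

Definition enorm a : R := Num.sqrt (dotr a a).

Definition bounded_domain Omega :=
  [/\ Omega !=set0, open Omega, connected Omega & bounded_set Omega].

(* Functions on Omega are represented by total functions, of which only the
   values on Omega matter; [f \_ Omega] is the extension by 0.  Measurability is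
   Borel measurability: every class of Lebesgue measurable functions modulo
   almost everywhere equality has a Borel representative. *)
Definition Lp Omega (p : \bar R) : set ('rV[R]_n -> R) :=
  [set f | (f \_ Omega) \in Lfun mu p].

Definition Lp_norm Omega (p : \bar R) (f : 'rV[R]_n -> R) : \bar R :=
  ('N[mu]_p[EFin \o (f \_ Omega)])%E.

Definition partial (i : 'I_n) (phi : 'rV[R]_n -> R) : 'rV[R]_n -> R :=
  fun x => 'D_(delta_mx 0 i) phi x.

Definition gradient (phi : 'rV[R]_n -> R) : 'rV[R]_n -> 'rV[R]_n :=
  fun x => \row_i partial i phi x.

Definition smooth (phi : 'rV[R]_n -> R) :=
  forall s : seq 'I_n, let psi := foldr partial phi s in
    continuous psi /\ forall i x, derivable psi x (delta_mx 0 i : 'rV[R]_n).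

Definition test_function Omega : set ('rV[R]_n -> R) :=
  [set phi | [/\ smooth phi, compact (closure [set x | phi x != 0])
               & closure [set x | phi x != 0] `<=` Omega]].

Definition weak_gradient Omega (u : 'rV[R]_n -> R) (g : 'rV[R]_n -> 'rV[R]_n) :=
  forall (i : 'I_n) phi, test_function Omega phi ->
    \int[mu]_(x in Omega) (u x * partial i phi x) =
    - \int[mu]_(x in Omega) (g x 0 i * phi x).

Definition H1 Omega : set (sobolev_pair R n) :=
  [set w : sobolev_pair R n | [/\ Lp Omega 2%:E w.1,
               forall i, Lp Omega 2%:E (fun x => (w.2 x) 0 i)
             & weak_gradient Omega w.1 w.2]].

Definition H10 Omega : set (sobolev_pair R n) :=
  [set w | H1 Omega w /\ exists phi : nat -> 'rV[R]_n -> R,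
    [/\ forall k, test_function Omega (phi k),
        Lp_norm Omega 2%:E (fun x => w.1 x - phi k x) @[k --> \oo] --> 0%E
      & Lp_norm Omega 2%:E (fun x => enorm (w.2 x - gradient (phi k) x))
          @[k --> \oo] --> 0%E]].

Definition H10_norm Omega (w : sobolev_pair R n) : \bar R :=
  Lp_norm Omega 2%:E (fun x => enorm (w.2 x)).

(* Only the values on H10 of an element of the dual space matter.  The bound
   makes it insensitive to the choice of representatives. *)
Definition Hm1 Omega : set (sobolev_pair R n -> R) :=
  [set f | (forall (c : R) u v, H10 Omega u -> H10 Omega v ->
              f (c *: u + v) = c * f u + f v) /\
           exists C : R, forall v, H10 Omega v ->
             (`|f v|%:E <= C%:E * H10_norm Omega v)%E].

Definition Hm1_norm Omega (f : sobolev_pair R n -> R) : \bar R :=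
  ereal_sup [set `|f v|%:E |
             v in [set v | H10 Omega v /\ (H10_norm Omega v <= 1)%E]].

Definition Hm1_H10_norm Omega
    (T : (sobolev_pair R n -> R) -> sobolev_pair R n) : \bar R :=
  ereal_sup [set H10_norm Omega (T f) |
             f in [set f | Hm1 Omega f /\ (Hm1_norm Omega f <= 1)%E]].

Definition admissible Omega (sigma0 sigma1 : R) : set ('rV[R]_n -> R) :=
  [set sigma | Lp Omega +oo%E sigma /\
     {ae mu, forall x, Omega x -> sigma0 <= sigma x <= sigma1}].

Definition weak_solution Omega (sigma : 'rV[R]_n -> R) (f : sobolev_pair R n -> R)
    : set (sobolev_pair R n) :=
  [set u | H10 Omega u /\ forall v, H10 Omega v ->
     \int[mu]_(x in Omega) (sigma x * dotr (u.2 x) (v.2 x)) = f v].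

(* The weak solution is unique up to equality almost everywhere: [xget] picks a
   representative, and would return 0 if there were no weak solution. *)
Definition resolvent Omega (sigma : 'rV[R]_n -> R) (f : sobolev_pair R n -> R)
    : sobolev_pair R n :=
  xget 0 (weak_solution Omega sigma f).

End sobolev.

(* Main.v *)
Require Import Defs.
From mathcomp Require Import all_boot all_order all_algebra.
From mathcomp Require Import all_classical all_reals all_analysis.
From mathcomp Require Import measurable_realfun ess_sup_inf.
From mathcomp Require Import ring lra.

Import Order.TTheory GRing.Theory Num.Theory.
Import numFieldNormedType.Exports.

Set Implicit Arguments.
Unset Strict Implicit.
Unset Printing Implicit Defensive.

Local Open Scope classical_set_scope.
Local Open Scope ring_scope.

(** Write [A_a u = - div (a Du)] and measure functions of [H10] by the L2 norm of
    their gradient.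

    Upper bound. Let [u] and [u'] solve the equation with the same right-hand side
    [f], of dual norm at most 1, for the coefficients [a] and [b], and let
    [w = u - u']. Subtracting the equations and testing against [w] gives
    [s0 |Dw|^2 <= |a - b|_oo |Du'| |Dw|], while testing the equation of [u'] against
    [u'] gives [s0 |Du'| <= 1] ([resolvent_diff_le]).

    Lower bound. Let [N] be the norm of the difference of the resolvents. For a test
    function [u], apply both resolvents to [f = A_a u]: the first returns [u], the
    second some [w] with [|D(w - u)| <= N |f| <= N s1 |Du|], and the integral of
    [(a - b) |Du|^2] equals that of [b D(w - u) . Du]. Hence
    [|int (a - b) |Du|^2| <= L int |Du|^2] with [L = s1^2 N] ([energy_diff_le_sqr]).
    Take for [u] the two oscillating functions [phi sin(c x_0) / c] and
    [phi cos(c x_0) / c]: their energy densities add up to [phi^2 + |Dphi|^2 / c^2],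
    so that letting [c] tend to infinity leaves
    [|int (a - b) phi^2| <= L int phi^2] ([energy_bound_to_L2]). Indicators of Borel
    subsets of small cubes are L2 limits of test functions ([approximable_in_cube]), so
    [phi] may be taken to be the indicator of the part of a cube where [a - b > L] or
    [b - a > L]; this part is therefore negligible ([ae_bound_of_quadratic]).

    Both bounds need the weak solutions to exist, since the resolvent has a junk value
    otherwise. Existence is Lax-Milgram ([exists_weak_solution]), which rests on the
    completeness of [H10] for the norm of the gradient: this follows from the
    completeness of L2 ([riesz_fischer]) and the Poincare inequality ([poincare]). The
    latter, and the fact that the gradient of a test function is its weak gradient,
    come from the vanishing of the integral of a partial derivative of a test function
    ([integral_partial]).

    The coefficients are bounded only almost everywhere; they are replaced at once by
    truncations that satisfy the bounds everywhere ([clip]), which changes neither the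
    resolvents nor the essential supremum. *)

(** * Cubes and the Borel sets of R^n *)

Section cubes.
Context {R : realType} {n : nat}.
Implicit Types (c x : 'rV[R]_n) (r : R) (U : set 'rV[R]_n).

Definition cube c r : set 'rV[R]_n := [set x | forall i, `|x 0 i - c 0 i| < r].
Definition ccube c r : set 'rV[R]_n := [set x | forall i, `|x 0 i - c 0 i| <= r].

Lemma cube_sub_ccube c r : cube c r `<=` ccube c r.
Proof. by move=> x cx i; exact: ltW. Qed.

Lemma measurable_forall_ord (P : 'I_n -> set 'rV[R]_n) :
  (forall i, measurable (P i)) -> measurable [set x | forall i, P i x].
Proof.
move=> mP; rewrite (_ : [set x | _] = \bigcap_(i in [set: 'I_n]) P i).
  by apply: fin_bigcap_measurable => // i _; exact: mP.
by apply/seteqP; split=> x Px i //=; exact: Px.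
Qed.

Lemma measurable_cube c r : measurable (cube c r).
Proof.
apply: measurable_forall_ord => i.
rewrite [X in measurable X](_ : _ = rV_coord i @^-1` `]c 0 i - r, c 0 i + r[).
  by rewrite -[_ @^-1` _]setTI; apply: measurable_rV_coord => //; exact: measurable_itv.
by apply/seteqP; split=> x /=; rewrite in_itv/= ltr_distl.
Qed.

Lemma measurable_ccube c r : measurable (ccube c r).
Proof.
apply: measurable_forall_ord => i.
rewrite [X in measurable X](_ : _ = rV_coord i @^-1` `[c 0 i - r, c 0 i + r]).
  by rewrite -[_ @^-1` _]setTI; apply: measurable_rV_coord => //; exact: measurable_itv.
by apply/seteqP; split=> x /=; rewrite in_itv/= ler_distl.
Qed.

Definition rat_cube (p : 'rV[rat]_n * nat) : set 'rV[R]_n :=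
  cube (map_mx ratr p.1) (2 ^- p.2).
Definition rat_ccube (p : 'rV[rat]_n * nat) : set 'rV[R]_n :=
  ccube (map_mx ratr p.1) (2 ^- p.2).

(** The closed cube is kept inside [U], so that a function supported in it has
    compact support in [U]. *)
Lemma open_rat_cube U x : open U -> U x ->
  exists2 p, rat_cube p x & rat_ccube p `<=` U.
Proof.
move=> oU Ux; have /nbhs_ballP[e /= e0 eU] : nbhs x U by exact: open_nbhs_nbhs.
have [k ke] : exists k, (2 ^- k : R) < e / 2.
  have e20 : 0 < (e / 2)^-1 by rewrite invr_gt0 divr_gt0.
  exists (Num.bound (e / 2)^-1); rewrite -[ltRHS]invrK ltf_pV2 ?posrE ?exprn_gt0//.
  apply: (@lt_trans _ _ (Num.bound (e / 2)^-1)%:R).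
    exact/archi_boundP/ltW.
  by rewrite -natrX ltr_nat ltn_expl.
have k0 : 0 < (2 ^- k : R) by rewrite invr_gt0 exprn_gt0.
have /choice[q qP] : forall i : 'I_n, exists q : rat, `|x 0 i - ratr q| < 2 ^- k.
  move=> i; have [|q] := @rat_in_itvoo R (x 0 i - 2 ^- k) (x 0 i + 2 ^- k).
    by rewrite ltrD2l; lra.
  by rewrite in_itv/= => xq; exists q; rewrite distrC ltr_distl.
exists (\row_i q i, k) => [i/=|y /= yq]; first by rewrite !mxE.
apply: eU; split => // a i; rewrite ord1 /ball/=.
have := yq i; have := qP i; rewrite !mxE => h1 h2.
rewrite (_ : _ - _ = (x 0 i - ratr (q i)) - (y 0 i - ratr (q i))); last by ring.
rewrite (le_lt_trans (ler_normB _ _))//; lra.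
Qed.

Lemma open_rat_cubes U : open U ->
  U = \bigcup_(p : 'rV[rat]_n * nat)
        if `[< rat_ccube p `<=` U >] then rat_cube p else set0.
Proof.
move=> oU; apply/seteqP; split=> [x Ux|x [p _]].
  by have [p px pU] := open_rat_cube oU Ux; exists p => //; rewrite ifT//; exact/asboolP.
by case: ifPn => // /asboolP pU px; apply: pU; exact: cube_sub_ccube.
Qed.

Lemma measurable_open U : open U -> measurable U.
Proof.
move=> /open_rat_cubes ->; apply: countable_bigcupT_measurable => // p.
by case: ifPn => // _; exact: measurable_cube.
Qed.

Lemma measurable_fun_continuous (f : 'rV[R]_n -> R) :
  continuous f -> measurable_fun setT f.
Proof.
move=> /continuousP cf; apply: (measurability _ (RGenOpens.measurableE R)).
move=> _ [_ [a [b ->] <-]]; rewrite setTI; apply: measurable_open; apply: cf.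
exact: interval_open.
Qed.

End cubes.

Lemma lebesgue_ccube_lty {R : realType} n (M : R) :
  (lebesgue_rV n (ccube 0 M) < +oo)%E.
Proof.
elim: n => [|n ih].
  by rewrite (le_lt_trans (probability_le1 _ _)) ?ltry//; exact: measurable_ccube.
rewrite /= /lebesgue_rV_succ /pushforward.
rewrite (_ : _ @^-1` _ = `[- M, M]%classic `*` ccube 0 M); last first.
  apply/seteqP; split=> [[t y] h|[t y] [ht hy] i]; last first.
    rewrite !mxE subr0; case: unliftP => [j _|_].
      by have := hy j; rewrite mxE subr0.
    by rewrite ler_norml; move: ht; rewrite /= in_itv.
  split=> [|i].
    by have := h ord0; rewrite !mxE unlift_none subr0/= in_itv/= ler_norml.
  by have := h (lift ord0 i); rewrite !mxE liftK.
rewrite product_measure1E ?lte_mul_pinfty//; last exact: measurable_ccube.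
  rewrite ge0_fin_numE// [X in (X < _)%E](lebesgue_measure_itv `[- M, M])/=.
  by case: ifPn; rewrite ?ltry// -EFinD ltry.
Qed.

(** * Integrals over R^n.+1 by Fubini *)

Section bounded_support.
Context {R : realType}.

(** No continuity is required: what is kept is enough for Fubini's theorem, and passes
    to the slices of [f]. *)
Definition bounded_bsupport n (f : 'rV[R]_n -> R) :=
  exists M, (forall x, `|f x| <= M) /\ (forall x, ~ ccube 0 M x -> f x = 0).

Lemma integrable_bsupp n (f : 'rV[R]_n -> R) : measurable_fun setT f -> bounded_bsupport f ->
  (lebesgue_rV n).-integrable setT (EFin \o f).
Proof.
move=> mf [M [fM f0]].
have -> : EFin \o f = (EFin \o f) \_ (ccube 0 M).
  apply/funext => x; rewrite patchE; case: ifPn => //= /negP xM.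
  by rewrite f0// => h; apply: xM; rewrite inE.
apply/integrable_restrict => //; first exact: measurable_ccube.
rewrite setTI; apply: measurable_bounded_integrable.
- exact: measurable_ccube.
- exact: lebesgue_ccube_lty.
- exact: measurable_funTS.
- by exists M; split; [exact: num_real|move=> y My x _; exact: le_trans (ltW My)].
Qed.

Lemma integral_lebesgue_rV_succ n (f : 'rV[R]_n.+1 -> R) :
  measurable_fun setT f -> (lebesgue_rV n.+1).-integrable setT (EFin \o f) ->
  (lebesgue_measure \x lebesgue_rV n)%E.-integrable setT (EFin \o f \o @rV_cons R n) /\
  (\int[lebesgue_rV n.+1]_x (f x)%:E =
   \int[(lebesgue_measure \x lebesgue_rV n)%E]_p (f (rV_cons p))%:E)%E.
Proof.
move=> mf /integrableP[_ foo].
have /measurable_EFinP mF := mf.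
have iF : (lebesgue_measure \x lebesgue_rV n)%E.-integrable setT
    (EFin \o f \o @rV_cons R n).
  apply/integrableP; split.
    by apply: measurableT_comp => //; exact: measurable_rV_cons.
  move: foo; rewrite ge0_integral_pushforward//; first exact: measurable_rV_cons.
  exact: measurableT_comp.
split => //.
rewrite [LHS](integral_pushforward (@measurable_rV_cons R n))//.
Qed.

Lemma integral_rV_succ_y n (f : 'rV[R]_n.+1 -> R) :
  measurable_fun setT f -> bounded_bsupport f ->
  (forall t, \int[lebesgue_rV n]_y (f (rV_cons (t, y)))%:E = 0)%E ->
  (\int[lebesgue_rV n.+1]_x (f x)%:E = 0)%E.
Proof.
move=> mf bf f0; have [iF ->] := integral_lebesgue_rV_succ mf (integrable_bsupp mf bf).
rewrite -(integral12_prod_meas1 iF); apply: integral0_eq => t _.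
exact: f0.
Qed.

Lemma integral_rV_succ_t n (f : 'rV[R]_n.+1 -> R) :
  measurable_fun setT f -> bounded_bsupport f ->
  (forall y, \int[lebesgue_measure]_t (f (rV_cons (t, y)))%:E = 0)%E ->
  (\int[lebesgue_rV n.+1]_x (f x)%:E = 0)%E.
Proof.
move=> mf bf f0; have [iF ->] := integral_lebesgue_rV_succ mf (integrable_bsupp mf bf).
rewrite -(integral21_prod_meas1 iF); apply: integral0_eq => t _.
exact: f0.
Qed.

Lemma integral_derive_bsupp (F f : R -> R) (M : R) :
  (forall t : R, is_derive t 1 F (f t)) -> continuous f ->
  (forall t, ~ `|t| <= M -> F t = 0) -> (forall t, ~ `|t| <= M -> f t = 0) ->
  (\int[lebesgue_measure]_t (f t)%:E = 0)%E.
Proof.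
move=> dF cf F0 f0.
have [N N0 MN] : exists2 N : R, 0 < N & M < N.
  by exists (Num.max 1 (M + 1)); rewrite lt_max ?ltr01// ltrDl ltr01 orbT.
have -> : (\int[lebesgue_measure]_t (f t)%:E =
           \int[lebesgue_measure]_(t in `[(- N)%R, N]) (f t)%:E)%E.
  rewrite [RHS]integral_mkcond; apply: eq_integral => t _.
  rewrite patchE; case: ifPn => // /negP tN; rewrite f0// => tM; apply: tN.
  by rewrite inE/= in_itv/= -ler_norml; apply: (le_trans tM); exact: ltW.
have cF : continuous F by move=> t; apply/differentiable_continuous/derivable1_diffP; case: (dF t).
rewrite (@continuous_FTC2 _ f F); last 4 first.
- lra.
- exact: continuous_subspaceT.
- split => [x _||]; first by case: (dF x).
  + apply: cvg_at_right_filter; exact: cF.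
  + apply: cvg_at_left_filter; exact: cF.
- by move=> x _; rewrite derive1E; case: (dF x).
rewrite !F0 ?subee// => h.
- by move: h; rewrite normrN gtr0_norm//; lra.
- by move: h; rewrite gtr0_norm//; lra.
Qed.

End bounded_support.

Section integral_partial.
Context {R : realType}.

Lemma is_derive_line (V : normedModType R) (f : V -> R) (x v : V) (t : R) :
  derivable f (x + t *: v) v ->
  is_derive t 1 (fun s : R => f (x + s *: v)) ('D_v f (x + t *: v)).
Proof.
have E : (fun h : R => h^-1 *: (((fun s : R => f (x + s *: v)) \o shift t) (h *: 1)
            - f (x + t *: v))) =
         (fun h : R => h^-1 *: ((f \o shift (x + t *: v)) (h *: v) - f (x + t *: v))).
  apply/funext => h /=; congr (_ *: (f _ - _)).
  by rewrite [h *: 1]mulr1 scalerDl addrCA.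
by move=> df; split; rewrite /derivable /derive E.
Qed.

Lemma rV_cons_line n (t s : R) (y : 'rV[R]_n) :
  rV_cons (s, y) = rV_cons (t, y) + (s - t) *: delta_mx 0 ord0.
Proof.
apply/rowP => i; rewrite !mxE; case: unliftP => [j ->|->] /=; last by rewrite mulr1; ring.
by rewrite mulr0 addr0.
Qed.

Lemma rV_consD n (t : R) (y z : 'rV[R]_n) :
  rV_cons (t, z + y) = rV_cons (0, z) + rV_cons (t, y).
Proof.
by apply/rowP => i; rewrite !mxE; case: unliftP => [j _|_] /=; rewrite ?mxE ?add0r.
Qed.

Lemma rV_cons_delta n (s : R) (j : 'I_n) :
  rV_cons (0, s *: delta_mx 0 j) = s *: delta_mx 0 (lift ord0 j) :> 'rV[R]_n.+1.
Proof.
apply/rowP => i; rewrite !mxE; case: unliftP => [k ->|->] /=; last by rewrite mulr0.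
by rewrite !mxE (inj_eq lift_inj).
Qed.

(** By Fubini the integral may be taken first along the i-th coordinate, where the
    fundamental theorem of calculus gives zero. For the induction on the dimension,
    continuity is only assumed along that coordinate. *)
Lemma integral_partial n (i : 'I_n) (f : 'rV[R]_n -> R) :
  measurable_fun setT (partial i f) -> bounded_bsupport f -> bounded_bsupport (partial i f) ->
  (forall x, derivable f x (delta_mx 0 i : 'rV[R]_n)) ->
  (forall x, continuous (fun t : R => partial i f (x + t *: delta_mx 0 i))) ->
  (\int[lebesgue_rV n]_x (partial i f x)%:E = 0)%E.
Proof.
elim: n i f => [[]//|n ih] i f mdf bf bdf df cdf.
have [M [fM f0]] := bf; have [M' [dfM df0]] := bdf.
case: (unliftP ord0 i) => [j ij|i0]; last first.
  move: mdf df cdf bdf dfM df0; rewrite {}i0 => mdf df cdf bdf dfM df0.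
  apply: integral_rV_succ_t => // y.
  have out N t : ~ `|t| <= N -> ~ ccube 0 N (rV_cons (t, y)).
    by move=> tN h; apply: tN; have := h ord0; rewrite !mxE unlift_none subr0.
  have E : (fun t => partial ord0 f (rV_cons (t, y))) =
           (fun t => partial ord0 f (rV_cons (0, y) + t *: delta_mx 0 ord0)).
    by apply/funext => t; rewrite (rV_cons_line 0) subr0.
  apply: (@integral_derive_bsupp _ (fun t => f (rV_cons (t, y))) _ (Num.max M M')).
  - move=> t; rewrite (rV_cons_line 0) subr0.
    rewrite (_ : (fun _ => _) = (fun s : R => f (rV_cons (0, y) + s *: delta_mx 0 ord0))).
      exact: is_derive_line.
    by apply/funext => s; rewrite (rV_cons_line 0) subr0.
  - by rewrite E.
  - by move=> t tM; apply/f0/out => h; apply: tM; rewrite le_max h.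
  - by move=> t tM; apply/df0/out => h; apply: tM; rewrite le_max h orbT.
have E t y : (fun h : R => h^-1 *: (((fun z => f (rV_cons (t, z))) \o shift y)
                 (h *: delta_mx 0 j) - f (rV_cons (t, y)))) =
             (fun h : R => h^-1 *: ((f \o shift (rV_cons (t, y))) (h *: delta_mx 0 i)
                 - f (rV_cons (t, y)))).
  by apply/funext => h /=; rewrite rV_consD rV_cons_delta -ij.
have pE t : partial j (fun z => f (rV_cons (t, z))) = (fun y => partial i f (rV_cons (t, y))).
  by apply/funext => y; rewrite /partial /derive E.
apply: integral_rV_succ_y => // t.
have out N y : ~ ccube 0 N y -> ~ ccube 0 N (rV_cons (t, y)).
  by move=> yN h; apply: yN => k; have := h (lift ord0 k); rewrite !mxE liftK.
have := ih j (fun y => f (rV_cons (t, y))); rewrite pE; apply.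
- have mc : measurable_fun [set: 'rV[R]_n] (fun y => (t, y) : measurableTypeR R * _).
    exact: measurable_pair1.
  by apply: measurableT_comp => //; apply: measurableT_comp => //; exact: measurable_rV_cons.
- by exists M; split => // y yM; apply/f0/out.
- by exists M'; split => // y yM; apply/df0/out.
- by move=> y; rewrite /derivable E; exact: df.
- move=> y; rewrite (_ : (fun _ => _) =
    (fun s : R => partial i f (rV_cons (t, y) + s *: delta_mx 0 i))) //.
  by apply/funext => s; rewrite addrC rV_consD rV_cons_delta -ij addrC.
Qed.

End integral_partial.

(** * Flat functions of one variable *)

Section exp_bump.
Context {R : realType}.

(** Induction on the polynomial: a factor [x] is absorbed by half of the exponent,
    since [x <= (2 / a) * expR (a / 2 * x)]. *)
Lemma poly_le_expR (p : {poly R}) (a : R) : 0 < a ->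
  exists C, forall x, 0 <= x -> `|p.[x]| <= C * expR (a * x).
Proof.
elim/poly_ind: p a => [|p c ih] a a0.
  by exists 0 => x _; rewrite horner0 normr0 mul0r.
have a20 : 0 < a / 2 by rewrite divr_gt0.
have [C CP] := ih _ a20.
exists (C * (2 / a) + `|c|) => x x0.
have C0 : 0 <= C.
  by have := CP 0 (lexx _); rewrite mulr0 expR0 mulr1; apply: le_trans.
have e1 : x <= 2 / a * expR (a / 2 * x).
  rewrite -ler_pdivrMl ?divr_gt0// invf_div.
  by apply: le_trans (expR_ge1Dx _); rewrite lerDr.
have e2 : 1 <= expR (a * x) by rewrite -expR0 ler_expR mulr_ge0// ltW.
have -> : expR (a * x) = expR (a / 2 * x) * expR (a / 2 * x).
  by rewrite -expRD; congr expR; field.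
rewrite hornerMXaddC (le_trans (ler_normD _ _))// mulrDl lerD//.
  rewrite normrM (ger0_norm x0).
  rewrite (_ : _ * _ = C * expR (a / 2 * x) * (2 / a * expR (a / 2 * x))); last by ring.
  by rewrite ler_pM// CP.
rewrite ler_peMr//.
by rewrite -expRD (_ : _ + _ = a * x)//; field.
Qed.

(** For p = 1 this is the classical flat function exp(-1/t); polynomials in 1/t
    are carried along so that the family is stable under differentiation. *)
Definition flat (p : {poly R}) (t : R) : R :=
  if t <= 0 then 0 else p.[t^-1] * expR (- t^-1).

(** The quadratic bound gives the derivative at 0. *)
Lemma flat_le_sqr p : exists C, forall t, `|flat p t| <= C * t ^+ 2.
Proof.
have [C CP] := poly_le_expR ('X^2 * p) (@ltr01 R).
have C0 : 0 <= C.
  by have := CP 0 (lexx _); rewrite mulr0 expR0 mulr1; apply: le_trans.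
exists C => t; rewrite /flat; case: ifPn => [_|]; first by rewrite normr0 mulr_ge0// sqr_ge0.
rewrite -ltNge => t0.
have ti : 0 <= t^-1 by rewrite invr_ge0 ltW.
have := CP _ ti; rewrite hornerM hornerXn mul1r !normrM (ger0_norm (expR_ge0 _)) expRN.
rewrite ger0_norm ?sqr_ge0// => h.
rewrite ler_pdivrMr ?expR_gt0// mulrAC -ler_pdivrMr ?exprn_gt0//.
by rewrite mulrC -exprVn.
Qed.

Definition flat_deriv (p : {poly R}) := 'X^2 * (p - p^`()).

Lemma is_derive_flat p (t : R) : is_derive t (1 : R) (flat p) (flat (flat_deriv p) t).
Proof.
have [t0|t0|->] := ltgtP t 0.
- apply: (@near_eq_is_derive _ _ _ (fun=> 0)).
    near=> s; rewrite /flat ifT//; apply: ltW; near: s; exact: lt_nbhsl.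
  by rewrite /flat (ltW t0); exact: is_derive_cst.
- have tn0 : t != 0 by rewrite gt_eqF.
  apply: (@near_eq_is_derive _ _ _ ((horner p \o (fun s : R => s^-1)) * (expR \o (fun s : R => - s^-1)))).
    near=> s; rewrite /flat ifF//=; apply/negbTE; rewrite -ltNge; near: s; exact: lt_nbhsr.
  rewrite /flat leNgt t0/=.
  have dV : is_derive t 1 (fun s : R => s^-1) (- t ^- 2 *: 1) by exact: is_deriveV.
  have dp := is_derive1_comp (is_derive_poly p t^-1) dV.
  have dN : is_derive t 1 (fun s : R => - s^-1) (- (- t ^- 2 *: 1)) by exact: is_deriveN.
  have de := @is_derive1_comp _ expR (fun s : R => - s^-1) _ _ _ (is_derive_expR (- t^-1)) dN.
  apply: is_derive_eq (is_deriveM dp de) _ => /=.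
  rewrite /flat_deriv hornerM hornerXn hornerD hornerN /GRing.scale/= exprVn.
  by ring.
- have [C CP] := flat_le_sqr p.
  have f0 : flat p 0 = 0 by rewrite /flat lexx.
  have h : (fun h : R => h^-1 *: ((flat p \o shift 0) (h *: 1) - flat p 0)) @ 0^' --> (0 : R).
    have C0 : 0 <= C by have := CP 1; rewrite expr1n mulr1; apply: le_trans.
    have C1 : 0 < C + 1 by rewrite ltr_wpDl.
    apply/cvgrPdist_le => e e0; near=> s.
    have s0 : s != 0 by near: s; exact: nbhs_dnbhs_neq.
    rewrite sub0r normrN f0 subr0 /= addr0 [s *: 1]mulr1 normrM normfV.
    rewrite ler_pdivrMl ?normr_gt0// (le_trans (CP s))// -[s ^+ 2]ger0_norm ?sqr_ge0//.
    rewrite normrX expr2 mulrA mulrC ler_wpM2l//.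
    have : `|s| <= e / (C + 1).
      by near: s; apply: dnbhs0_le; rewrite divr_gt0.
    rewrite ler_pdivlMr// => h; apply: le_trans h.
    by rewrite mulrDr mulr1 [C * _]mulrC lerDl.
  split.
    by apply/cvg_ex; exists 0.
  by rewrite /derive (cvg_lim _ h)// /flat lexx.
Unshelve. all: by end_near. Qed.

Lemma flat1_ge0 t : 0 <= flat 1 t.
Proof. by rewrite /flat; case: ifPn => // _; rewrite hornerC mul1r expR_ge0. Qed.

Lemma flat1_le1 t : flat 1 t <= 1.
Proof.
rewrite /flat; case: ifPn => // t0; rewrite hornerC mul1r -expR0 ler_expR oppr_le0 invr_ge0.
by rewrite ltW// ltNge.
Qed.

Lemma flat1_neq0 t : (flat 1 t != 0) = (0 < t).
Proof.
rewrite /flat; case: ltP => [t0|t0]; last by rewrite eqxx.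
by rewrite hornerC mul1r gt_eqF// expR_gt0.
Qed.

End exp_bump.

(** * Smooth functions of several variables *)

Section smooth.
Context {R : realType} {n : nat}.
Implicit Types f g : 'rV[R]_n -> R.

(** Regularity of finite order, by recursion on the order: unlike [smooth], it
    can be established by induction. *)
Fixpoint Ck k f : Prop :=
  continuous f /\
  if k is k'.+1 then
    (forall i x, derivable f x (delta_mx 0 i : 'rV[R]_n)) /\
    (forall i, Ck k' (partial i f))
  else True.

Lemma Ck_continuous k f : Ck k f -> continuous f. Proof. by case: k => [|k] []. Qed.

Lemma CkW k f : Ck k.+1 f -> Ck k f.
Proof.
elim: k f => [|k ih] f [cf [df pf]]; first by split.
by split => //; split => // i; exact/ih.
Qed.

Lemma smooth_partial f i : smooth f -> smooth (partial i f).
Proof. by move=> sf s; have := sf (rcons s i); rewrite foldr_rcons. Qed.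

Lemma smoothP f : smooth f <-> (forall k, Ck k f).
Proof.
split=> [sf k|Cf s].
  elim: k f sf => [|k ih] f sf.
    by split => //; have [] := sf [::].
  have [cf df] := sf [::].
  by split => //; split => // i; exact/ih/smooth_partial.
elim/last_ind: s f Cf => [|s i ih] f Cf /=.
  by have [cf [df _]] := Cf 1%N.
by rewrite foldr_rcons; apply: ih => k; case: (Cf k.+1) => _ [_]; exact.
Qed.

Lemma Ck_cst k (c : R) : Ck k (fun=> c).
Proof.
elim: k c => [|k ih] c; split; try exact: cst_continuous; first by [].
split=> [i x|i]; first exact: derivable_cst.
rewrite (_ : partial _ _ = fun=> 0)//.
by apply/funext => x; rewrite /partial derive_cst.
Qed.

Lemma CkD k f g : Ck k f -> Ck k g -> Ck k (fun x => f x + g x).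
Proof.
elim: k f g => [|k ih] f g [cf Cf] [cg Cg].
  by split => // x; exact: cvgD (cf x) (cg x).
split; first by move=> x; exact: cvgD (cf x) (cg x).
have [df pf] := Cf; have [dg pg] := Cg.
split=> [i x|i]; first exact: derivableD (df i x) (dg i x).
rewrite (_ : partial _ _ = fun x => partial i f x + partial i g x); first exact: ih _ _ (pf i) (pg i).
by apply/funext => x; exact: deriveD (df i x) (dg i x).
Qed.

Lemma CkM k f g : Ck k f -> Ck k g -> Ck k (fun x => f x * g x).
Proof.
elim: k f g => [|k ih] f g Cf Cg.
  by split => // x; apply: (@continuousM R _ f g x); [exact: (Ck_continuous Cf)|exact: (Ck_continuous Cg)].
have [cf [df pf]] := Cf; have [cg [dg pg]] := Cg.
split; first by move=> x; apply: (@continuousM R _ f g x); [exact: cf|exact: cg].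
split=> [i x|i]; first exact: derivableM (df i x) (dg i x).
rewrite (_ : partial _ _ = fun x => f x * partial i g x + g x * partial i f x).
  by apply: CkD; apply: ih; [exact: CkW Cf|exact: pg|exact: CkW Cg|exact: pf].
by apply/funext => x; exact: deriveM (df i x) (dg i x).
Qed.

Lemma is_derive_coord (h : R -> R) (h' : R) (i j : 'I_n) (x : 'rV[R]_n) :
  is_derive (x 0 i) 1 h h' ->
  is_derive x (delta_mx 0 j : 'rV[R]_n) (fun y => h (y 0 i)) (if i == j then h' else 0).
Proof.
move=> dh; case: eqP => [<-|/eqP ij].
  have E : (fun t : R => t^-1 *: (((fun y => h (y 0 i)) \o shift x) (t *: delta_mx 0 i) - h (x 0 i)))
         = (fun t : R => t^-1 *: ((h \o shift (x 0 i)) (t *: 1) - h (x 0 i))).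
    by apply/funext => t /=; rewrite !mxE !eqxx.
  by case: dh => dh <-; split; rewrite /derivable /derive E.
have E : (fun t : R => t^-1 *: (((fun y => h (y 0 i)) \o shift x) (t *: delta_mx 0 j) - h (x 0 i)))
         = (fun t : R => 0).
  apply/funext => t /=; rewrite !mxE (negbTE ij) andbF mulr0 add0r subrr.
  by rewrite scaler0.
split; rewrite /derivable /derive E; first exact: is_cvg_cst.
by rewrite lim_cst.
Qed.

Lemma Ck_coord k (h h' : R -> R) (i : 'I_n) : (forall t : R, is_derive t 1 h (h' t)) ->
  Ck k (fun x => h' (x 0 i)) -> Ck k.+1 (fun x => h (x 0 i)).
Proof.
move=> dh Ch'; split.
  move=> x; apply: (@continuous_comp _ _ _ (fun y : 'rV[R]_n => y 0 i) h).
    exact: coord_continuous.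
  by apply/differentiable_continuous/derivable1_diffP; case: (dh (x 0 i)).
split=> [j x|j]; first by case: (is_derive_coord j (dh (x 0 i))).
rewrite (_ : partial _ _ = fun x => (if i == j then 1 else 0) * h' (x 0 i)).
  by apply: CkM => //; exact: Ck_cst.
apply/funext => x; rewrite /partial; case: (is_derive_coord j (dh (x 0 i))) => _ ->.
by case: ifP; rewrite ?mul1r ?mul0r.
Qed.

Lemma smooth_cst (c : R) : smooth (fun _ : 'rV[R]_n => c).
Proof. by apply/smoothP => k; exact: Ck_cst. Qed.

Lemma smoothD f g : smooth f -> smooth g -> smooth (fun x => f x + g x).
Proof. by move=> /smoothP sf /smoothP sg; apply/smoothP => k; exact: CkD. Qed.

Lemma smoothM f g : smooth f -> smooth g -> smooth (fun x => f x * g x).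
Proof. by move=> /smoothP sf /smoothP sg; apply/smoothP => k; exact: CkM. Qed.

Lemma smooth_prod (I : Type) (r : seq I) (F : I -> 'rV[R]_n -> R) :
  (forall i, smooth (F i)) -> smooth (fun x => \prod_(i <- r) F i x).
Proof.
move=> sF; elim: r => [|i r ih].
  rewrite (_ : (fun _ => _) = fun=> 1); first exact: smooth_cst.
  by apply/funext => x; rewrite big_nil.
rewrite (_ : (fun _ => _) = fun x => F i x * \prod_(j <- r) F j x); first exact: smoothM.
by apply/funext => x; rewrite big_cons.
Qed.

Lemma smoothX f m : smooth f -> smooth (fun x => f x ^+ m).
Proof.
move=> sf; elim: m => [|m ih]; first exact: smooth_cst.
rewrite (_ : (fun _ => _) = fun x => f x * f x ^+ m); first exact: (smoothM sf ih).
by apply/funext => x; rewrite exprS.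
Qed.

Lemma smooth_sin_cos (c : R) (i : 'I_n) :
  smooth (fun x => sin (c * x 0 i)) /\ smooth (fun x => cos (c * x 0 i)).
Proof.
suff h k : Ck k (fun x : 'rV[R]_n => sin (c * x 0 i)) /\
           Ck k (fun x : 'rV[R]_n => cos (c * x 0 i)).
  by split; apply/smoothP => k; case: (h k).
have dl (t : R) : is_derive t 1 (fun s : R => c * s) c.
  by apply: is_derive_eq (is_deriveZ _ _) _; rewrite [_ *: _]mulr1.
have ds (t : R) : is_derive t 1 (fun s : R => sin (c * s)) (c * cos (c * t)).
  apply: is_derive_eq (is_derive1_comp (is_derive_sin (c * t)) (dl t)) _.
  by rewrite mulrC.
have dc (t : R) : is_derive t 1 (fun s : R => cos (c * s)) (- c * sin (c * t)).
  apply: is_derive_eq (is_derive1_comp (is_derive_cos (c * t)) (dl t)) _.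
  by rewrite mulrC mulrN mulNr.
elim: k => [|k [ihs ihc]].
  split; split => // x.
    apply: (@continuous_comp _ _ _ (fun y : 'rV[R]_n => y 0 i) (fun s => sin (c * s))).
      exact: coord_continuous.
    by apply/differentiable_continuous/derivable1_diffP; case: (ds (x 0 i)).
  apply: (@continuous_comp _ _ _ (fun y : 'rV[R]_n => y 0 i) (fun s => cos (c * s))).
    exact: coord_continuous.
  by apply/differentiable_continuous/derivable1_diffP; case: (dc (x 0 i)).
split; [apply: (Ck_coord ds)|apply: (Ck_coord dc)];
  by apply: CkM => //; exact: Ck_cst.
Qed.

Lemma smooth_flat (p : {poly R}) (a b : R) (i : 'I_n) :
  smooth (fun x => flat p (a * x 0 i + b)).
Proof.
apply/smoothP => k.
have dl (t : R) : is_derive t 1 (fun s : R => a * s + b) a.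
  have dZ : is_derive t 1 (fun s : R => a * s) a.
    by apply: is_derive_eq (is_deriveZ _ _) _; rewrite [_ *: _]mulr1.
  by have := is_deriveD dZ (is_derive_cst b t 1); rewrite addr0.
have df (q : {poly R}) (t : R) : is_derive t 1 (fun s : R => flat q (a * s + b))
    (a * flat (flat_deriv q) (a * t + b)).
  rewrite [a * flat _ _]mulrC.
  exact: (@is_derive1_comp _ (flat q) (fun s => a * s + b) _ _ _ (is_derive_flat q (a * t + b)) (dl t)).
elim: k p => [|k ih] p.
  split => // x.
  apply: (@continuous_comp _ _ _ (fun y : 'rV[R]_n => y 0 i) (fun s => flat p (a * s + b))).
    exact: coord_continuous.
  by apply/differentiable_continuous/derivable1_diffP; case: (df p (x 0 i)).
by apply: (Ck_coord (df p)); apply: CkM => //; exact: Ck_cst.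
Qed.

Lemma smooth_derivable f i x : smooth f -> derivable f x (delta_mx 0 i : 'rV[R]_n).
Proof. by move=> sf; have [] := sf [::]. Qed.

Lemma smooth_continuous f : smooth f -> continuous f.
Proof. by move=> sf; have [] := sf [::]. Qed.

Lemma smooth_measurable f : smooth f -> measurable_fun setT f.
Proof. by move=> /smooth_continuous; exact: measurable_fun_continuous. Qed.

Lemma partialD f g i x : smooth f -> smooth g ->
  partial i (fun x => f x + g x) x = partial i f x + partial i g x.
Proof. by move=> sf sg; apply: deriveD; exact: smooth_derivable. Qed.

Lemma partialM f g i x : smooth f -> smooth g ->
  partial i (fun x => f x * g x) x = f x * partial i g x + g x * partial i f x.
Proof. by move=> sf sg; apply: deriveM; exact: smooth_derivable. Qed.

Lemma partial_cst (c : R) i (x : 'rV[R]_n) : partial i (fun=> c) x = 0.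
Proof. by rewrite /partial derive_cst. Qed.

Lemma partialZ c f i x : smooth f -> partial i (fun x => c * f x) x = c * partial i f x.
Proof.
by move=> sf; rewrite (partialM i x (smooth_cst c) sf) partial_cst mulr0 addr0.
Qed.

End smooth.

(** * Test functions *)

Section test_functions.
Context {R : realType} {n : nat}.
Implicit Types (f g phi psi : 'rV[R]_n -> R) (Omega : set 'rV[R]_n).

Lemma coord_le_norm (x : 'rV[R]_n) i : `|x 0 i| <= `|x|.
Proof.
rewrite [leRHS]/Num.norm/= mx_normrE.
exact: (@le_bigmax _ _ _ 0 (fun ij => `|x ij.1 ij.2|) (0, i)).
Qed.

Lemma compact_ccube (c : 'rV[R]_n) r : compact (ccube c r).
Proof.
rewrite (_ : ccube c r = [set v | forall i, `[c 0 i - r, c 0 i + r]%classic (v ord0 i)]).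
  apply: (rV_compact (A := fun i => `[c 0 i - r, c 0 i + r]%classic)) => i.
  exact: segment_compact.
by apply/seteqP; split=> x h i; have := h i; rewrite /= in_itv/= ler_distl.
Qed.

Lemma test_function_smooth Omega f : test_function Omega f -> smooth f.
Proof. by case. Qed.

Lemma test_function_sub Omega f g : test_function Omega f -> smooth g ->
  (forall x, g x != 0 -> closure [set x | f x != 0] x) -> test_function Omega g.
Proof.
move=> [sf cf fO] sg gf.
have gfc : closure [set x | g x != 0] `<=` closure [set x | f x != 0].
  rewrite [X in _ `<=` X](closure_id _).1; last exact: closed_closure.
  exact: closure_subset.
split => //; last exact: subset_trans fO.
by apply: subclosed_compact cf gfc; exact: closed_closure.
Qed.

Lemma test_functionM Omega f g : smooth f -> test_function Omega g ->
  test_function Omega (fun x => f x * g x).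
Proof.
move=> sf tg; apply: (test_function_sub tg).
  exact: (smoothM sf (test_function_smooth tg)).
move=> x; rewrite mulf_eq0 negb_or => /andP[_ gx]; exact: subset_closure.
Qed.

Lemma test_functionD Omega f g : test_function Omega f -> test_function Omega g ->
  test_function Omega (fun x => f x + g x).
Proof.
move=> [sf cf fO] [sg cg gO].
have fgc : closure [set x | f x + g x != 0] `<=`
    closure [set x | f x != 0] `|` closure [set x | g x != 0].
  rewrite -closureU; apply: closure_subset => x /=.
  by case: (eqVneq (f x) 0) => [->|]; [rewrite add0r; right|left].
split; first exact: smoothD.
- apply: subclosed_compact fgc; first exact: closed_closure.
  exact: compactU.
- by apply: (subset_trans fgc) => x [/fO|/gO].
Qed.

Lemma test_function_partial Omega i f : test_function Omega f ->
  test_function Omega (partial i f).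
Proof.
move=> tf; apply: (test_function_sub tf).
  exact/smooth_partial/(test_function_smooth tf).
move=> x; apply: contraNP => /= xf.
have /closed_openC oC : closed (closure [set x | f x != 0]) by exact: closed_closure.
rewrite /partial (@near_eq_derive _ _ _ _ (fun=> 0)) ?derive_cst//.
apply: filterS (open_nbhs_nbhs (conj oC xf)) => y /= yf.
by apply/eqP/negP => /negP fy; apply: yf; exact: subset_closure.
Qed.

Lemma test_function_bsupp Omega f : test_function Omega f -> bounded_bsupport f.
Proof.
move=> [sf cf fO].
have /compact_bounded[M [_ MP]] := cf.
have /compact_bounded[N [_ NP]] : compact (f @` closure [set x | f x != 0]).
  by apply: continuous_compact => //; apply: continuous_subspaceT; exact: smooth_continuous.
pose L := Num.max 0 (Num.max (M + 1) (N + 1)).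
have ML : M < L by rewrite !lt_max ltrDl ltr01 orbT.
have NL : N < L by rewrite !lt_max ltrDl ltr01 !orbT.
exists L; split=> x.
  have [->|fx] := eqVneq (f x) 0; first by rewrite normr0 le_max lexx.
  by apply: NP NL _ _; exists x => //; exact: subset_closure.
move=> xL; apply/eqP/negP => /negP fx; apply: xL => i; rewrite mxE subr0.
apply: le_trans (coord_le_norm x i) _.
by apply: MP ML _ _; exact: subset_closure.
Qed.

Lemma test_function_out Omega f x : test_function Omega f -> ~ Omega x -> f x = 0.
Proof.
by move=> [_ _ fO] xO; apply/eqP/negP => /negP fx; apply/xO/fO; exact: subset_closure.
Qed.

Lemma test_function_ccube Omega f c r : ccube c r `<=` Omega -> smooth f ->
  (forall x, f x != 0 -> ccube c r x) -> test_function Omega f.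
Proof.
move=> cO sf fc.
have fcc : closure [set x | f x != 0] `<=` ccube c r.
  have /closure_id -> : closed (ccube c r).
    by apply: compact_closed; [exact: norm_hausdorff|exact: compact_ccube].
  exact: closure_subset.
split => //; last exact: subset_trans cO.
exact: subclosed_compact (@closed_closure _ _) (@compact_ccube c r) fcc.
Qed.

End test_functions.

(** * Positive forms and approximate Riesz representation *)

Section forms.
Context {R : realType}.

(** The optimal weight is [t = b / a]; both numbers are shifted by a small [e] because
    they may vanish. *)
Lemma le_mul_of_le_weighted (a b X : R) : 0 <= a -> 0 <= b ->
  (forall t, 0 < t -> 2 * X <= t * a ^+ 2 + t^-1 * b ^+ 2) -> X <= a * b.
Proof.
move=> a0 b0 h; suff : 2 * X <= 2 * (a * b) by lra.
apply/ler_addgt0Pr => e0 e00.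
have ab0 : 0 < a + b + 1 by lra.
(* At weight [(b + e) / (a + e)] the bound is at most [2 * a * b + e * (a + b)]. *)
pose e := e0 / (a + b + 1).
have e_gt0 : 0 < e by rewrite divr_gt0.
have ae : 0 < a + e by lra.
have be : 0 < b + e by lra.
have := h ((b + e) / (a + e)) (divr_gt0 be ae); rewrite invf_div.
have h1 : (b + e) / (a + e) * a ^+ 2 <= (b + e) * a.
  rewrite -mulrA ler_pM2l// ler_pdivrMl// expr2 ler_wpM2r//; lra.
have h2 : (a + e) / (b + e) * b ^+ 2 <= (a + e) * b.
  rewrite -mulrA ler_pM2l// ler_pdivrMl// expr2 ler_wpM2r//; lra.
have he : e * (a + b + 1) = e0 by rewrite /e divfK// gt_eqF.
move=> H; nra.
Qed.

Context {V : lmodType R}.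

Record psd_form (S : set V) (B : V -> V -> R) : Prop := PsdForm {
  form_dom0 : S 0;
  form_domD : forall (c : R) u v, S u -> S v -> S (c *: u + v);
  form_sym : forall u v, S u -> S v -> B u v = B v u;
  form_lin : forall (c : R) u v w, S u -> S v -> S w ->
    B (c *: u + v) w = c * B u w + B v w;
  form_ge0 : forall u, S u -> 0 <= B u u }.

Context (S : set V) (B : V -> V -> R) (HB : psd_form S B).

Lemma form_quad c u v : S u -> S v ->
  B (c *: u + v) (c *: u + v) = c ^+ 2 * B u u + 2 * c * B u v + B v v.
Proof.
move=> Su Sv; have Sw := form_domD HB c Su Sv.
rewrite (form_lin HB)// (form_sym HB Su Sw) (form_sym HB Sv Sw) !(form_lin HB)//.
rewrite (form_sym HB Sv Su); ring.
Qed.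

Lemma form_domB u v : S u -> S v -> S (u - v).
Proof. by move=> Su Sv; have := form_domD HB (-1) Sv Su; rewrite scaleN1r addrC. Qed.

Lemma form_linB u v w : S u -> S v -> S w -> B (u - v) w = B u w - B v w.
Proof.
move=> Su Sv Sw; have := form_lin HB (-1) Sv Su Sw.
by rewrite scaleN1r addrC => ->; ring.
Qed.

Lemma form_cauchy_schwarz u v : S u -> S v ->
  `|B u v| <= Num.sqrt (B u u) * Num.sqrt (B v v).
Proof.
suff h w z : S w -> S z -> B w z <= Num.sqrt (B w w) * Num.sqrt (B z z).
  move=> Su Sv; rewrite ler_norml h// andbT.
  have S0 := form_dom0 HB; have SNu := form_domB S0 Su; rewrite sub0r in SNu.
  have B0 z : S z -> B 0 z = 0.
    by move=> Sz; have := form_linB S0 S0 Sz; rewrite !subrr.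
  have BN z : S z -> B (- u) z = - B u z.
    by move=> Sz; have := form_linB S0 Su Sz; rewrite B0// !sub0r.
  have := h _ _ SNu Sv; rewrite (BN _ Sv) (BN _ SNu) (form_sym HB Su SNu) (BN _ Su) opprK; lra.
move=> Sw Sz; apply: le_mul_of_le_weighted; rewrite ?sqrtr_ge0// => t t0.
rewrite !sqr_sqrtr ?(form_ge0 HB)//.
have := form_ge0 HB (form_domD HB (- t) Sw Sz); rewrite form_quad// => H.
by rewrite -(ler_pM2l t0) [in leRHS]mulrDr (mulrA t t^-1) divff ?gt_eqF//; lra.
Qed.

Lemma form_norm_lin c u v : S u -> S v ->
  Num.sqrt (B (c *: u + v) (c *: u + v)) <= `|c| * Num.sqrt (B u u) + Num.sqrt (B v v).
Proof.
move=> Su Sv.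
have nu := sqrtr_ge0 (B u u); have nv := sqrtr_ge0 (B v v).
have n0 : 0 <= `|c| * Num.sqrt (B u u) + Num.sqrt (B v v) by rewrite addr_ge0// mulr_ge0.
rewrite -[leRHS]ger0_norm// -sqrtr_sqr ler_sqrt ?sqr_ge0// form_quad//.
have : c * B u v <= `|c| * (Num.sqrt (B u u) * Num.sqrt (B v v)).
  rewrite (le_trans (ler_norm _))// normrM ler_wpM2l//; exact: form_cauchy_schwarz.
rewrite sqrrD exprMn real_normK ?num_real// !sqr_sqrtr ?(form_ge0 HB)// => h.
lra.
Qed.

(** Riesz representation in a space that need not be complete: a functional that
    is bounded for the form is the limit of the functionals [B (v k)] along a
    Cauchy sequence, which is a minimizing sequence of [B u u - 2 * f u]. *)
Lemma approximate_riesz (f : V -> R) (C : R) :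
  (forall c u v, S u -> S v -> f (c *: u + v) = c * f u + f v) ->
  (forall u, S u -> `|f u| <= C * Num.sqrt (B u u)) ->
  exists v : nat -> V, [/\ forall k, S (v k),
    forall k w, S w -> `|B (v k) w - f w| <= 2 ^- k * Num.sqrt (B w w)
    & forall k l, Num.sqrt (B (v k - v l) (v k - v l)) <= 2 ^- k + 2 ^- l].
Proof.
move=> flin fC.
pose J u := B u u - 2 * f u.
pose A := [set J u | u in S].
have hasA : has_inf A.
  split; first by exists (J 0); exists 0 => //; exact: form_dom0 HB.
  exists (- C ^+ 2) => _ [u Su <-]; rewrite /J.
  have := fC _ Su; rewrite ler_norml => /andP[_].
  have := form_ge0 HB Su; move/sqr_sqrtr; set s := Num.sqrt _ => <- h.
  have := sqr_ge0 (s - C); rewrite sqrrB; lra.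
have eps0 k : 0 < (2 ^- k) ^+ 2 :> R by rewrite exprn_gt0// invr_gt0 exprn_gt0.
have /choice[v vP] : forall k, exists u, S u /\ J u < inf A + (2 ^- k) ^+ 2.
  move=> k; have [_ [u Su <-] Ju] := inf_adherent (eps0 k) hasA.
  by exists u.
have half k w : S w -> B (v k) w - f w <= 2 ^- k * Num.sqrt (B w w).
  move=> Sw; have [Svk Jk] := vP k.
  rewrite mulrC; apply: le_mul_of_le_weighted; rewrite ?sqrtr_ge0//.
  move=> t t0; rewrite sqr_sqrtr ?(form_ge0 HB)//.
  have Sx := form_domD HB (- t) Sw Svk.
  have : inf A <= J (- t *: w + v k).
    by apply: ge_inf; [case: hasA|exists (- t *: w + v k)].
  rewrite /J form_quad// flin// (form_sym HB Sw Svk) => Jx.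
  have : 0 <= (2 ^- k) ^+ 2 + t ^+ 2 * B w w - 2 * t * (B (v k) w - f w).
    by move: Jk; rewrite /J; lra.
  move=> H; rewrite -(ler_pM2l t0) [in leRHS]mulrDr (mulrA t t^-1) divff ?gt_eqF//; nra.
have bnd k w : S w -> `|B (v k) w - f w| <= 2 ^- k * Num.sqrt (B w w).
  move=> Sw; have [Svk _] := vP k; rewrite ler_norml half// andbT.
  have S0 := form_dom0 HB.
  have SNw : S (- w) by have := form_domB S0 Sw; rewrite sub0r.
  have B0 z : S z -> B 0 z = 0.
    by move=> Sz; have := form_linB S0 S0 Sz; rewrite !subrr.
  have f0 : f 0 = 0 by have := flin (-1) 0 0 S0 S0; rewrite scaler0 addr0; lra.
  have := half k _ SNw.
  have -> : - w = (-1) *: w + 0 by rewrite scaleN1r addr0.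
  rewrite form_quad// flin// (form_sym HB Svk (form_domD HB (-1) Sw S0)) (form_lin HB)//.
  rewrite !(form_sym HB Sw) ?B0// (form_sym HB Svk Sw) f0 !addr0 mulr0 addr0.
  by rewrite sqrrN expr1n mul1r; lra.
exists v; split => //; first by move=> k; case: (vP k).
move=> k l; have [[Svk _] [Svl _]] := (vP k, vP l).
have Sw := form_domB Svk Svl.
set w := v k - v l in Sw *; have := bnd k w Sw; have := bnd l w Sw.
rewrite !ler_norml => /andP[hl1 hl2] /andP[hk1 hk2].
have Bw : B w w = B (v k) w - B (v l) w by rewrite {1}/w form_linB.
have := sqr_sqrtr (form_ge0 HB Sw); set s := Num.sqrt _ in hl1 hl2 hk1 hk2 *.
have s0 : 0 <= s by exact: sqrtr_ge0.
have [->|sn0] := eqVneq s 0; first by rewrite addr_ge0// invr_ge0 exprn_ge0.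
have sp : 0 < s by rewrite lt_neqAle eq_sym sn0.
move=> ss; rewrite -(ler_pM2r sp) -expr2 ss mulrDl Bw; lra.
Qed.

End forms.

(** * Square integrable functions *)

Section L2.
Context d (T : measurableType d) (R : realType).
Variables (mu : {measure set T -> \bar R}) (D : set T).
Hypothesis mD : measurable D.
Implicit Types f g h : T -> R.

Definition square_integrable f := measurable_fun D f /\ mu.-integrable D (fun x => (f x ^+ 2)%:E).

Lemma integrable_le f g : measurable_fun D f -> mu.-integrable D (EFin \o g) ->
  (forall x, D x -> `|f x| <= g x) -> mu.-integrable D (EFin \o f).
Proof.
move=> mf ig fg; apply: le_integrable ig => //; first exact/measurable_EFinP.
by move=> x Dx /=; rewrite lee_fin (le_trans (fg x Dx))// ler_norm.
Qed.

Lemma integrable_mulc c f : mu.-integrable D (EFin \o f) ->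
  mu.-integrable D (EFin \o (fun x => c * f x)).
Proof. by move=> jf; have := integrableZl mD c jf. Qed.

Lemma integrable_add f g : mu.-integrable D (EFin \o f) -> mu.-integrable D (EFin \o g) ->
  mu.-integrable D (EFin \o (fun x => f x + g x)).
Proof. by move=> jf jg; have := integrableD mD jf jg. Qed.

Lemma norm_mul_le (a b : R) : `|a * b| <= a ^+ 2 + b ^+ 2.
Proof.
have := sqr_ge0 (a + b); have := sqr_ge0 (a - b); move=> h1 h2.
have := sqr_ge0 a; have := sqr_ge0 b => h3 h4.
by rewrite ler_norml; apply/andP; split; lra.
Qed.

Lemma sqi_mul f g : square_integrable f -> square_integrable g -> mu.-integrable D (EFin \o (fun x => f x * g x)).
Proof.
move=> [mf jf] [mg jg].
apply: (@integrable_le _ (fun x => f x ^+ 2 + g x ^+ 2)).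
- exact: measurable_funM.
- exact: integrable_add.
- by move=> x _; exact: norm_mul_le.
Qed.

Lemma sqi_le f g : measurable_fun D f -> square_integrable g -> (forall x, D x -> `|f x| <= `|g x|) -> square_integrable f.
Proof.
move=> mf [mg jg] fg; split => //; apply: (integrable_le (g := fun x => g x ^+ 2)) => //.
  exact: measurable_funX.
by move=> x Dx; rewrite normrX -[leRHS]ger0_norm ?sqr_ge0// normrX ler_sqr ?nnegrE// fg.
Qed.

Lemma sqiZD c f g : square_integrable f -> square_integrable g -> square_integrable (fun x => c * f x + g x).
Proof.
move=> sf sg; have [mf jf] := sf; have [mg jg] := sg.
have mh : measurable_fun D (fun x => c * f x + g x).
  by apply: measurable_funD => //; apply: measurable_funM.
split => //.
apply: (@integrable_le _ (fun x => 2 * c ^+ 2 * f x ^+ 2 + 2 * g x ^+ 2)).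
- exact: measurable_funX.
- by apply: integrable_add; exact: integrable_mulc.
- move=> x _; rewrite ger0_norm ?sqr_ge0//.
  by have := sqr_ge0 (c * f x - g x); lra.
Qed.

Lemma sqiB f g : square_integrable f -> square_integrable g -> square_integrable (fun x => f x - g x).
Proof.
move=> sf sg; have := sqiZD (-1) sg sf.
by under eq_fun do rewrite mulN1r addrC.
Qed.

Lemma RintegralZD c f g : mu.-integrable D (EFin \o f) -> mu.-integrable D (EFin \o g) ->
  \int[mu]_(x in D) (c * f x + g x) = c * \int[mu]_(x in D) f x + \int[mu]_(x in D) g x.
Proof.
move=> jf jg; rewrite RintegralD ?RintegralZl//.
exact: integrable_mulc.
Qed.

Lemma cauchy_schwarz f g : square_integrable f -> square_integrable g ->
  `|\int[mu]_(x in D) (f x * g x)| <=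
  Num.sqrt (\int[mu]_(x in D) (f x ^+ 2)) * Num.sqrt (\int[mu]_(x in D) (g x ^+ 2)).
Proof.
move=> sf sg; apply: le_mul_of_le_weighted; rewrite ?sqrtr_ge0// => t t0.
rewrite !sqr_sqrtr; try by apply: Rintegral_ge0 => x _; exact: sqr_ge0.
have jfg := sqi_mul sf sg; have [mf jf] := sf; have [mg jg] := sg.
have jt := integrable_mulc t^-1 jg.
rewrite -(RintegralZl _ mD jg) -RintegralZD//.
apply: le_trans (_ : 2 * \int[mu]_(x in D) `|f x * g x| <= _).
  by rewrite ler_pM2l//; exact: le_normr_Rintegral.
have jn : mu.-integrable D (EFin \o (fun x => `|f x * g x|)) by exact: integrable_norm.
rewrite -RintegralZl//; apply: le_Rintegral => //.
- exact: integrable_mulc.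
- by apply: integrable_add => //; exact: integrable_mulc.
- move=> x _; rewrite normrM -(normr_id (f x)) -(normr_id (g x)).
  rewrite -[f x ^+ 2]real_normK ?num_real// -[g x ^+ 2]real_normK ?num_real//.
  rewrite !normr_id; set a := `|f x|; set b := `|g x|.
  have e : t * a ^+ 2 + t^-1 * b ^+ 2 - 2 * (a * b) = t^-1 * (t * a - b) ^+ 2.
    by field; rewrite gt_eqF.
  by rewrite -subr_ge0 e mulr_ge0// ?invr_ge0 ?sqr_ge0// ltW.
Qed.

End L2.

(** * Completeness of L2 *)

Section riesz_fischer.
Context d (T : measurableType d) (R : realType).
Variables (mu : {measure set T -> \bar R}) (D : set T).
Hypothesis mD : measurable D.
Hypothesis Dfin : (mu D < +oo)%E.
Implicit Types f g h : T -> R.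

Lemma sqi_cst (c : R) : square_integrable mu D (fun=> c).
Proof.
split; first exact: measurable_cst.
apply: (@measurable_bounded_integrable _ _ _ mu (fun=> c ^+ 2)) => //.
by exists (c ^+ 2); split; [exact: num_real|move=> y cy x _; rewrite ger0_norm ?sqr_ge0// ltW].
Qed.

Lemma sqi_bounded f (M : R) : measurable_fun D f -> (forall x, D x -> `|f x| <= M) ->
  square_integrable mu D f.
Proof.
move=> mf fM; apply: (sqi_le mD mf (sqi_cst M)) => x Dx.
by rewrite (le_trans (fM x Dx))// ler_norm.
Qed.

Lemma sqi_integrable f : square_integrable mu D f -> mu.-integrable D (EFin \o f).
Proof.
move=> sf; have := sqi_mul mD sf (sqi_cst 1).
by under eq_fun do rewrite mulr1.
Qed.

Lemma sqi_abs f : square_integrable mu D f -> square_integrable mu D (fun x => `|f x|).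
Proof.
move=> sf; apply: (sqi_le mD _ sf); first by case: sf => mf _; exact: measurableT_comp.
by move=> x _; rewrite normr_id.
Qed.

Lemma EFin_Rintegral f : mu.-integrable D (EFin \o f) ->
  (\int[mu]_(x in D) f x)%:E = (\int[mu]_(x in D) (f x)%:E)%E.
Proof. by move=> jf; rewrite fineK//; exact: integrable_fin_num. Qed.

Lemma ae_cvg_of_summable (f : nat -> T -> R) :
  (forall k, measurable_fun D (f k)) ->
  (\sum_(0 <= k <oo) \int[mu]_(x in D) (`|f k.+1 x - f k x|)%:E < +oo)%E ->
  {ae mu, forall x, D x -> cvgn (f ^~ x)}.
Proof.
move=> mf foo.
pose g k x := (`|f k.+1 x - f k x|)%:E.
have mg k : measurable_fun D (g k).
  apply/measurable_EFinP; apply: measurableT_comp => //; exact: measurable_funB.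
have g0 k x : D x -> (0 <= g k x)%E by move=> _; rewrite lee_fin.
have jS : mu.-integrable D (fun x => \sum_(0 <= k <oo) g k x)%E.
  apply/integrableP; split; first by apply: (ge0_emeasurable_sum (P := xpredT)) => // k x Dx _; exact: g0.
  under eq_integral => x xD.
    rewrite gee0_abs; last by apply: nneseries_ge0 => k _ _; rewrite lee_fin.
    over.
  by rewrite integral_nneseries.
apply: filterS (integrable_ae mD jS) => x xfin Dx.
have {}xfin := xfin Dx.
pose s := fine (\sum_(0 <= k <oo) g k x)%E.
have cs : cvgn (series (telescope (f ^~ x))).
  apply: normed_cvg; apply: nondecreasing_is_cvgn.
    by apply/nondecreasing_seqP => k; rewrite /= [leRHS]seriesSr ler_wpDr//.
  exists s => _ [k _ <-]; rewrite -lee_fin /s fineK//.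
  rewrite /series/= -sumEFin; apply: nneseries_lim_ge => j _ _.
  by rewrite lee_fin.
rewrite (_ : f ^~ x = fun k => f 0%N x + series (telescope (f ^~ x)) k).
  by apply: is_cvgD => //; exact: is_cvg_cst.
by apply/funext => k; rewrite [LHS](@eq_sum_telescope _ (f ^~ x)).
Qed.

Lemma fatou_sqr_dist (f : nat -> T -> R) g h (c : R) :
  (forall k, square_integrable mu D (f k)) -> measurable_fun D g -> square_integrable mu D h ->
  {ae mu, forall x, D x -> f ^~ x @ \oo --> g x} ->
  (forall k, \int[mu]_(x in D) ((h x - f k x) ^+ 2) <= c) ->
  square_integrable mu D (fun x => h x - g x) /\ \int[mu]_(x in D) ((h x - g x) ^+ 2) <= c.
Proof.
move=> sf mg sh fg fc.
have mh : measurable_fun D h by case: sh.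
have mf k : measurable_fun D (f k) by case: (sf k).
have mhg : measurable_fun D (fun x => h x - g x) by exact: measurable_funB.
have m2 : measurable_fun D (fun x => ((h x - g x) ^+ 2)%:E).
  by apply/measurable_EFinP; exact: measurable_funX.
pose u k x := ((h x - f k x) ^+ 2)%:E.
have mu_ k : measurable_fun D (u k).
  by apply/measurable_EFinP; apply: measurable_funX; exact: measurable_funB.
have u0 k x : D x -> (0 <= u k x)%E by move=> _; rewrite lee_fin sqr_ge0.
have le_c : (\int[mu]_(x in D) ((h x - g x) ^+ 2)%:E <= c%:E)%E.
  have -> : (\int[mu]_(x in D) ((h x - g x) ^+ 2)%:E =
             \int[mu]_(x in D) limn_einf (u ^~ x))%E.
    apply: ae_eq_integral => //.
      by under eq_fun do rewrite /limn_einf; apply: measurableT_comp => //;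
         apply: measurable_fun_limn_esup => k; exact: measurableT_comp.
    apply: filterS fg => x fgx Dx.
    have cu : u ^~ x @ \oo --> ((h x - g x) ^+ 2)%:E.
      apply: cvg_EFin; first exact: nearW.
      apply: (@cvg_comp _ _ _ _ (fun y : R => y ^+ 2)); last exact: exprn_continuous.
      by apply: cvgB; [exact: cvg_cst|exact: fgx].
    by rewrite is_cvg_limn_einfE; [rewrite (cvg_lim _ cu)|apply/cvg_ex; eexists; exact: cu].
  apply: le_trans (fatou mu mD mu_ u0) _.
  rewrite limn_einf_lim; apply: lime_le; first exact: is_cvg_einfs.
  apply: nearW => k; apply: le_trans (_ : (\int[mu]_(x in D) u k x)%E <= _)%E.
    by apply: ereal_inf_lbound; exists k => /=.
  have [mB jB] := sqiB mD sh (sf k).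
  by rewrite /u -(EFin_Rintegral jB) lee_fin.
have shg : square_integrable mu D (fun x => h x - g x).
  split => //; apply/integrableP; split => //.
  under eq_integral do rewrite gee0_abs ?lee_fin ?sqr_ge0//.
  by rewrite (le_lt_trans le_c)// ltry.
split => //; have [_ jhg] := shg.
by rewrite -lee_fin (EFin_Rintegral jhg).
Qed.

(** Completeness of L2, for a sequence that is already rapidly Cauchy: on a set of
    finite measure the increments are summable in L1, so that the sequence
    converges almost everywhere, and Fatou's lemma controls the limit. *)
Lemma riesz_fischer (f : nat -> T -> R) (C : R) :
  (forall k, square_integrable mu D (f k)) ->
  (forall k l, (k <= l)%N ->
     Num.sqrt (\int[mu]_(x in D) ((f k x - f l x) ^+ 2)) <= C * 2 ^- k) ->
  exists g, square_integrable mu D g /\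
    forall k, Num.sqrt (\int[mu]_(x in D) ((f k x - g x) ^+ 2)) <= C * 2 ^- k.
Proof.
move=> sf fC.
have C0 : 0 <= C.
  by have := fC 0%N 0%N (leqnn _); rewrite expr0 invr1 mulr1; exact/le_trans/sqrtr_ge0.
have mf k : measurable_fun D (f k) by case: (sf k).
pose m := Num.sqrt (\int[mu]_(x in D) (1 ^+ 2)).
have summ : (\sum_(0 <= k <oo) \int[mu]_(x in D) (`|f k.+1 x - f k x|)%:E < +oo)%E.
  have m0 : 0 <= m by exact: sqrtr_ge0.
  apply: le_lt_trans (ltry (2 * (C * m))).
  apply: le_trans (epsilon_trick0 xpredT _); last by rewrite !mulr_ge0.
  apply: lee_nneseries => [k _ _|k _]; first exact: integral_ge0.
  have sd := sqi_abs (sqiB mD (sf k.+1) (sf k)).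
  rewrite -(EFin_Rintegral (sqi_integrable sd)) lee_fin.
  have := cauchy_schwarz mD sd (sqi_cst 1).
  under eq_Rintegral do rewrite mulr1.
  move=> /(le_trans (ler_norm _)) /le_trans; apply.
  under eq_Rintegral do rewrite real_normK ?num_real// -[_ - _]opprB sqrrN.
  apply: le_trans (ler_wpM2r m0 (fC _ _ (leqnSn k))) _.
  rewrite natrX exprS le_eqVlt; apply/orP; left; apply/eqP; field.
  by rewrite expf_neq0.
have cf := ae_cvg_of_summable mf summ.
(* A limit superior, to be measurable also where the sequence diverges. *)
pose g x := fine (limn_esup (fun k => (f k x)%:E)).
have mg : measurable_fun D g.
  apply: (measurableT_comp (@fine_measurable R setT measurableT)).
  by apply: measurable_fun_limn_esup => k; exact/measurable_EFinP.
have fg : {ae mu, forall x, D x -> f ^~ x @ \oo --> g x}.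
  apply: filterS cf => x cx Dx; have /cvg_ex[l fl] := cx Dx.
  have fl' : (fun k => (f k x)%:E) @ \oo --> l%:E by apply: cvg_EFin => //; exact: nearW.
  by rewrite /g is_cvg_limn_esupE; [rewrite (cvg_lim _ fl')|apply/cvg_ex; exists l%:E].
have key k : square_integrable mu D (fun x => f k x - g x) /\
    \int[mu]_(x in D) ((f k x - g x) ^+ 2) <= (C * 2 ^- k) ^+ 2.
  apply: (@fatou_sqr_dist (fun j => f (j + k)%N)) => //.
    apply: filterS fg => x fx Dx.
    by have := fx Dx; rewrite -(cvg_shiftn k); exact.
  move=> j; have h := fC k (j + k)%N (leq_addl _ _).
  rewrite -ler_sqrt; last by rewrite sqr_ge0.
  rewrite sqrtr_sqr ger0_norm//.
  by rewrite mulr_ge0// invr_ge0 exprn_ge0.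
exists g; split.
  have [s0 _] := key 0%N; have := sqiB mD (sf 0%N) s0.
  by under eq_fun do rewrite opprB addrCA subrr addr0.
move=> k; have [_ h] := key k.
have C2 : 0 <= C * 2 ^- k by rewrite mulr_ge0// invr_ge0 exprn_ge0.
by rewrite -[leRHS]ger0_norm// -sqrtr_sqr ler_sqrt// sqr_ge0.
Qed.

End riesz_fischer.

(** * Square integrable vector fields and energies *)

Section fields.
Context {R : realType} {n : nat}.
Variable Omega : set 'rV[R]_n.
Hypothesis mO : measurable Omega.
Local Notation mu := (lebesgue_rV n).
Local Notation L2 := (square_integrable mu Omega).
Implicit Types (f g : 'rV[R]_n -> R) (u v w : 'rV[R]_n -> 'rV[R]_n).

Lemma Lp_norm2E f : mu.-integrable Omega (fun x => (f x ^+ 2)%:E) ->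
  Lp_norm Omega 2%:E f = (Num.sqrt (\int[mu]_(x in Omega) (f x ^+ 2)))%:E.
Proof.
move=> jf; rewrite /Lp_norm unlock /Lnorm.
have -> : (\int[mu]_x `|(EFin \o (f \_ Omega)) x| `^ 2 =
           (\int[mu]_(x in Omega) (f x ^+ 2))%:E)%E.
  rewrite (EFin_Rintegral mO jf) [RHS]integral_mkcond; apply: eq_integral => x _ /=.
  rewrite !patchE; case: ifPn => _ /=.
    by rewrite powR_mulrn// real_normK ?num_real.
  by rewrite normr0 powR0.
by rewrite /= -powR12_sqrt// Rintegral_ge0// => x _; exact: sqr_ge0.
Qed.

Lemma Lp2P f : Lp Omega 2%:E f <-> L2 f.
Proof.
split.
  rewrite /Lp/= => fL; have := Lfun2_integrable_sqr fL => /= j2.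
  have : f \_ Omega \in @mfun _ _ _ R by exact: sub_Lfun_mfun fL.
  rewrite inE/= => mf; split; first exact/measurable_restrictT.
  have := (integrable_mkcond (fun x => (f x ^+ 2)%:E) mO).2; apply.
  rewrite (_ : _ \_ _ = EFin \o (fun x => (f \_ Omega) x ^+ 2))//.
  by apply/funext => x /=; rewrite !patchE; case: ifPn; rewrite ?expr0n.
move=> [mf jf]; rewrite /Lp/= inE; apply/andP; split; rewrite inE/=.
  by apply: (iffLR (measurable_restrictT _ _)).
by rewrite /finite_norm -/(Lp_norm Omega 2%:E f) Lp_norm2E// ltry.
Qed.

Definition field_L2 u := forall i, L2 (fun x => u x 0 i).

(** A coefficient is taken bounded everywhere, so that no exceptional null set
    has to be carried along. *)
Definition bounded_coef (a : 'rV[R]_n -> R) (K : R) :=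
  measurable_fun Omega a /\ forall x, `|a x| <= K.

Definition energy (a : 'rV[R]_n -> R) u v : R :=
  \int[mu]_(x in Omega) (a x * dotr (u x) (v x)).

Definition field_norm u : R := Num.sqrt (energy (fun=> 1) u u).

Lemma bounded_coef_cst (c : R) : bounded_coef (fun=> c) `|c|.
Proof. by split. Qed.

Lemma integrable_coef_mul a K f g : bounded_coef a K -> L2 f -> L2 g ->
  mu.-integrable Omega (EFin \o (fun x => a x * (f x * g x))).
Proof.
move=> [ma aK] sf sg; have jfg := sqi_mul mO sf sg.
have mfg : measurable_fun Omega (fun x => f x * g x).
  by case: sf sg => mf _ [mg _]; exact: measurable_funM.
apply: (integrable_le mO (g := fun x => K * `|f x * g x|)).
- exact: measurable_funM.
- by apply: integrable_mulc => //; exact: integrable_norm.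
- by move=> x _; rewrite normrM ler_wpM2r.
Qed.

Lemma integrable_bigsum (F : 'I_n -> 'rV[R]_n -> R) :
  (forall i, mu.-integrable Omega (EFin \o F i)) ->
  mu.-integrable Omega (EFin \o (fun x => \sum_i F i x)).
Proof.
move=> jF.
have := integrable_sum mO (index_enum 'I_n) (P := xpredT) (fun i _ => jF i).
rewrite (_ : (fun _ => _) = EFin \o (fun x => \sum_i F i x))//.
by apply/funext => x /=; rewrite sumEFin.
Qed.

Lemma Rintegral_bigsum (F : 'I_n -> 'rV[R]_n -> R) :
  (forall i, mu.-integrable Omega (EFin \o F i)) ->
  \int[mu]_(x in Omega) (\sum_i F i x) = \sum_i \int[mu]_(x in Omega) F i x.
Proof.
move=> jF; apply: EFin_inj.
rewrite (EFin_Rintegral mO (integrable_bigsum jF)) -sumEFin.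
under eq_integral do rewrite -sumEFin.
rewrite integral_sum//.
by apply: eq_bigr => i _; rewrite (EFin_Rintegral mO (jF i)).
Qed.

Lemma integrable_energy a K u v : bounded_coef a K -> field_L2 u -> field_L2 v ->
  mu.-integrable Omega (EFin \o (fun x => a x * dotr (u x) (v x))).
Proof.
move=> aK su sv; rewrite (_ : (fun _ => _) =
    (fun x => \sum_i (a x * (u x 0 i * v x 0 i)))).
  by apply: integrable_bigsum => i; exact: (integrable_coef_mul aK).
by apply/funext => x; rewrite /dotr mulr_sumr.
Qed.

Lemma dotrC (x y : 'rV[R]_n) : dotr x y = dotr y x.
Proof. by apply: eq_bigr => i _; rewrite mulrC. Qed.

Lemma dotr_lin c (x y z : 'rV[R]_n) : dotr (c *: x + y) z = c * dotr x z + dotr y z.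
Proof.
rewrite /dotr mulr_sumr -big_split; apply: eq_bigr => i _ /=.
by rewrite !mxE; ring.
Qed.

Lemma dotr_ge0 (x : 'rV[R]_n) : 0 <= dotr x x.
Proof. by apply: sumr_ge0 => i _; rewrite -expr2 sqr_ge0. Qed.

Lemma field_L2D c u v : field_L2 u -> field_L2 v -> field_L2 (c *: u + v).
Proof.
move=> su sv i; have := sqiZD mO c (su i) (sv i).
by rewrite (_ : (fun _ => _) = (fun x => (c *: u + v) x 0 i))//;
  apply/funext => x; rewrite !mxE.
Qed.

Lemma energy_form a K : bounded_coef a K -> (forall x, 0 <= a x) ->
  psd_form field_L2 (energy a).
Proof.
move=> aK a0; split.
- move=> i; rewrite (_ : (fun _ => _) = (fun=> 0)); last by apply/funext => x; rewrite mxE.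
  split; first exact: measurable_cst.
  rewrite (_ : (fun _ => _) = (fun=> 0%E)); first exact: integrable0.
  by apply/funext => x; rewrite expr0n.
- exact: field_L2D.
- by move=> u v _ _; apply: eq_Rintegral => x _; rewrite dotrC.
- move=> c u v w su sv sw; rewrite /energy -RintegralZD//; last first.
  + exact: integrable_energy aK sv sw.
  + exact: integrable_energy aK su sw.
  by apply: eq_Rintegral => x _; rewrite dotr_lin; ring.
- by move=> u _; apply: Rintegral_ge0 => x _; rewrite mulr_ge0// dotr_ge0.
Qed.

Lemma energy1_form : psd_form field_L2 (energy (fun=> 1)).
Proof. exact: energy_form (bounded_coef_cst 1) _. Qed.

Lemma sqr_field_norm u : field_L2 u -> field_norm u ^+ 2 = energy (fun=> 1) u u.
Proof. by move=> su; rewrite sqr_sqrtr// (form_ge0 energy1_form). Qed.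

Lemma dotr_le_weighted (t : R) (x y : 'rV[R]_n) : 0 < t ->
  2 * `|dotr x y| <= t * dotr x x + t^-1 * dotr y y.
Proof.
move=> t0; apply: le_trans (_ : 2 * \sum_i `|x 0 i * y 0 i| <= _).
  by rewrite ler_pM2l// ler_norm_sum.
rewrite /dotr !mulr_sumr -big_split; apply: ler_sum => i _ /=.
rewrite normrM -!expr2 -[x 0 i ^+ 2]real_normK ?num_real//.
rewrite -[y 0 i ^+ 2]real_normK ?num_real//.
set a := `|x 0 i|; set b := `|y 0 i|.
have e : t * a ^+ 2 + t^-1 * b ^+ 2 - 2 * (a * b) = t^-1 * (t * a - b) ^+ 2.
  by field; rewrite gt_eqF.
by rewrite -subr_ge0 e mulr_ge0// ?invr_ge0 ?sqr_ge0// ltW.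
Qed.

(** The coefficient may change sign, so that the energy need not be a positive form;
    the weighted inequality is applied pointwise, before integrating. *)
Lemma energy_bound a K u v : bounded_coef a K -> field_L2 u -> field_L2 v ->
  `|energy a u v| <= K * (field_norm u * field_norm v).
Proof.
move=> aK su sv; have [ma aK'] := aK.
have K0 : 0 <= K := le_trans (normr_ge0 _) (aK' 0).
have fn0 w : 0 <= field_norm w by exact: sqrtr_ge0.
rewrite mulrA; apply: le_mul_of_le_weighted; rewrite ?mulr_ge0// => t t0.
have [K0'|Kn0] := eqVneq K 0.
  rewrite /energy (@eq_Rintegral _ _ _ mu Omega (fun=> 0)); last first.
    move=> x _; have := aK' x; rewrite K0' normr_le0 => /eqP ->.
    by rewrite mul0r.
  rewrite Rintegral_cst// mul0r normr0 mulr0 addr_ge0// mulr_ge0 ?sqr_ge0//.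
    exact: ltW.
  by rewrite invr_ge0 ltW.
have Kp : 0 < K by rewrite lt_neqAle eq_sym Kn0.
pose s := t * K.
have s0 : 0 < s by rewrite mulr_gt0.
have -> : t * (K * field_norm u) ^+ 2 + t^-1 * field_norm v ^+ 2 =
          K * (s * field_norm u ^+ 2 + s^-1 * field_norm v ^+ 2).
  by rewrite /s; field; rewrite Kn0 gt_eqF.
rewrite !sqr_field_norm//.
have j1 w : field_L2 w -> mu.-integrable Omega (EFin \o (fun x => 1 * dotr (w x) (w x))).
  by move=> sw; exact: (integrable_energy (bounded_coef_cst 1) sw sw).
have je := integrable_energy aK su sv.
have [ju jv] := (j1 u su, j1 v sv).
have jv' := integrable_mulc mO s^-1 jv.
rewrite -(RintegralZl _ mO jv) -RintegralZD// -RintegralZl//; last first.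
  by apply: integrable_add => //; exact: integrable_mulc.
apply: le_trans (_ : 2 * \int[mu]_(x in Omega) `|a x * dotr (u x) (v x)| <= _).
  by rewrite ler_pM2l//; exact: le_normr_Rintegral.
rewrite -RintegralZl//; last exact: integrable_norm.
apply: le_Rintegral => //.
- by apply: integrable_mulc => //; exact: integrable_norm.
- by do 2!(apply: integrable_mulc || apply: integrable_add) => //; exact: integrable_mulc.
- move=> x _; rewrite !mul1r normrM mulrCA.
  apply: le_trans (_ : K * (2 * `|dotr (u x) (v x)|) <= _).
    by rewrite ler_wpM2r// mulr_ge0.
  by rewrite ler_wpM2l// dotr_le_weighted.
Qed.

Lemma energy_coercive a K (s : R) u : bounded_coef a K -> (forall x, s <= a x) ->
  field_L2 u -> s * field_norm u ^+ 2 <= energy a u u.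
Proof.
move=> aK sa su; rewrite sqr_field_norm//.
have j1 := integrable_energy (bounded_coef_cst 1) su su.
rewrite -(RintegralZl _ mO j1); apply: le_Rintegral => //.
- exact: integrable_mulc.
- exact: (integrable_energy aK su su).
- by move=> x _; rewrite mul1r ler_wpM2r// dotr_ge0.
Qed.

Lemma field_norm_sum u : field_L2 u ->
  field_norm u ^+ 2 = \sum_i \int[mu]_(x in Omega) (u x 0 i ^+ 2).
Proof.
move=> su; rewrite sqr_field_norm// -Rintegral_bigsum => [|i]; last by case: (su i).
by apply: eq_Rintegral => x _; rewrite mul1r; apply: eq_bigr => i _; rewrite expr2.
Qed.

Lemma coord_norm_le u i : field_L2 u ->
  Num.sqrt (\int[mu]_(x in Omega) (u x 0 i ^+ 2)) <= field_norm u.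
Proof.
move=> su; have fn0 : 0 <= field_norm u by exact: sqrtr_ge0.
rewrite -[leRHS]ger0_norm// -sqrtr_sqr ler_sqrt ?sqr_ge0// field_norm_sum//.
rewrite (bigD1 i)//= lerDl; apply: sumr_ge0 => j _.
by apply: Rintegral_ge0 => x _; exact: sqr_ge0.
Qed.

Lemma field_norm_lin c u v : field_L2 u -> field_L2 v ->
  field_norm (c *: u + v) <= `|c| * field_norm u + field_norm v.
Proof. exact: form_norm_lin energy1_form c u v. Qed.

Lemma field_norm_ge0 u : 0 <= field_norm u. Proof. exact: sqrtr_ge0. Qed.

Lemma Lp_norm_enorm u : field_L2 u ->
  Lp_norm Omega 2%:E (fun x => enorm (u x)) = (field_norm u)%:E.
Proof.
move=> su; have j1 := integrable_energy (bounded_coef_cst 1) su su.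
have E x : enorm (u x) ^+ 2 = 1 * dotr (u x) (u x) by rewrite mul1r sqr_sqrtr// dotr_ge0.
rewrite Lp_norm2E; last by under eq_fun do rewrite E.
by congr (Num.sqrt _)%:E; apply: eq_Rintegral => x _; rewrite E.
Qed.

Lemma L2_form : psd_form L2 (fun f g => \int[mu]_(x in Omega) (f x * g x)).
Proof.
split.
- split; first exact: measurable_cst.
  rewrite (_ : (fun _ => _) = (fun=> 0%E)); first exact: integrable0.
  by apply/funext => x; rewrite expr0n.
- by move=> c f g; exact: sqiZD.
- by move=> f g _ _; apply: eq_Rintegral => x _; rewrite mulrC.
- move=> c f g h sf sg sh; rewrite -RintegralZD//; try exact: sqi_mul.
  by apply: eq_Rintegral => x _; rewrite mulrDl -mulrA.
- by move=> f _; apply: Rintegral_ge0 => x _; rewrite -expr2 sqr_ge0.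
Qed.

Lemma L2_norm_lin c f g : L2 f -> L2 g ->
  Num.sqrt (\int[mu]_(x in Omega) ((c * f x + g x) ^+ 2)) <=
  `|c| * Num.sqrt (\int[mu]_(x in Omega) (f x ^+ 2)) +
         Num.sqrt (\int[mu]_(x in Omega) (g x ^+ 2)).
Proof.
move=> sf sg; have := form_norm_lin L2_form c sf sg.
by under eq_Rintegral do rewrite -expr2.
Qed.

End fields.

(** * The Poincare inequality *)

Section sobolev_bounded.
Context {R : realType} {n : nat}.
Variables (Omega : set 'rV[R]_n.+1) (M : R).
Hypothesis oO : open Omega.
Hypothesis M0 : 0 <= M.
Hypothesis OM : Omega `<=` ccube 0 M.
Local Notation mu := (lebesgue_rV n.+1).
Local Notation L2 := (square_integrable mu Omega).
Implicit Types (f g phi psi : 'rV[R]_n.+1 -> R) (u v w : sobolev_pair R n.+1).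

Lemma bounded_open_measurable : measurable Omega. Proof. exact: measurable_open. Qed.
Local Notation mO := bounded_open_measurable.

Lemma bounded_open_lty : (mu Omega < +oo)%E.
Proof.
apply: le_lt_trans (lebesgue_ccube_lty n.+1 M).
by apply: le_measure => //; rewrite inE; [exact: mO|exact: measurable_ccube].
Qed.
Local Notation Ofin := bounded_open_lty.

Lemma test_function_sqi phi : test_function Omega phi -> L2 phi.
Proof.
move=> tp; have [K [phiK _]] := test_function_bsupp tp.
apply: (sqi_bounded mO Ofin (M := K)) => [|x _]; last exact: phiK.
by apply: measurable_funTS; apply: smooth_measurable; exact: test_function_smooth tp.
Qed.

Lemma test_function_integral_partial i phi : test_function Omega phi ->
  \int[mu]_(x in Omega) partial i phi x = 0.
Proof.
move=> tp; have tq := test_function_partial i tp.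
rewrite Rintegral_mkcond (_ : _ \_ _ = partial i phi); last first.
  apply/funext => x; rewrite patchE; case: ifPn => // /negP xO.
  by rewrite (test_function_out tq)// => Ox; apply: xO; rewrite inE.
rewrite /Rintegral integral_partial//.
- by apply: smooth_measurable; exact: (test_function_smooth tq).
- exact: test_function_bsupp tp.
- exact: test_function_bsupp tq.
- by move=> x; apply: smooth_derivable; exact: (test_function_smooth tp).
- move=> x t; apply: (@continuous_comp _ _ _ (fun s : R => x + s *: delta_mx 0 i)).
    apply: continuousD; first exact: cst_continuous.
    exact: scalel_continuous.
  exact: (smooth_continuous (test_function_smooth tq)).
Qed.

Lemma gradientE phi x i : gradient phi x 0 i = partial i phi x.
Proof. by rewrite mxE. Qed.

Lemma test_function_field_L2 phi : test_function Omega phi -> field_L2 Omega (gradient phi).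
Proof.
move=> tp i; under eq_fun do rewrite gradientE.
by apply: test_function_sqi; exact: test_function_partial.
Qed.

(** Integration by parts: the partial derivative of [phi * psi] has integral zero. *)
Lemma test_function_weak_gradient phi : test_function Omega phi ->
  weak_gradient Omega phi (gradient phi).
Proof.
move=> tp i psi tq.
have sp := test_function_smooth tp; have sq := test_function_smooth tq.
have tpq : test_function Omega (fun x => phi x * psi x) by exact: test_functionM.
have := test_function_integral_partial i tpq.
rewrite (@eq_Rintegral _ _ _ mu Omega (fun x => phi x * partial i psi x + gradient phi x 0 i * psi x)); last first.
  by move=> x _; rewrite partialM// gradientE (mulrC (psi x)).
rewrite RintegralD; first by move/eqP; rewrite addr_eq0 => /eqP.
- exact: mO.
- exact: (sqi_mul mO (test_function_sqi tp) (test_function_sqi (test_function_partial i tq))).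
- under eq_fun do rewrite gradientE.
  exact: (sqi_mul mO (test_function_sqi (test_function_partial i tp)) (test_function_sqi tq)).
Qed.

Lemma smooth_coord i : smooth (fun x : 'rV[R]_n.+1 => x 0 i).
Proof.
apply/smoothP => -[|k].
  by split => //; exact: coord_continuous.
by apply: (@Ck_coord _ _ k id (fun=> 1)) => //; exact: Ck_cst.
Qed.

Definition L2norm f : R := Num.sqrt (\int[mu]_(x in Omega) (f x ^+ 2)).

Lemma L2norm_ge0 f : 0 <= L2norm f. Proof. exact: sqrtr_ge0. Qed.

(** The Poincare inequality: the derivative of [x_0 * phi^2] along the first
    coordinate has integral zero, hence the square of the norm of [phi] is the
    integral of [- 2 * x_0 * phi * d_0 phi]. *)
Lemma poincare phi : test_function Omega phi ->
  L2norm phi <= 2 * M * field_norm Omega (gradient phi).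
Proof.
move=> tp; have sp := test_function_smooth tp.
have tq := test_function_partial ord0 tp; have sq := test_function_smooth tq.
pose X (x : 'rV[R]_n.+1) := x 0 ord0.
have sX : smooth X by exact: smooth_coord.
have t2 : test_function Omega (fun x => X x * (phi x * phi x)).
  exact: (test_functionM sX (test_functionM sp tp)).
have tXq : test_function Omega (fun x => X x * partial ord0 phi x) by exact: test_functionM.
have dX x : partial ord0 X x = 1.
  have := is_derive_coord (i := ord0) ord0 (is_derive_id (x 0 ord0) (1 : R)).
  by rewrite eqxx => -[_].
have [L2p L2q] := (test_function_sqi tp, test_function_sqi tXq).
have := test_function_integral_partial ord0 t2.
rewrite (@eq_Rintegral _ _ _ mu Omega (fun x => 2 * (phi x * (X x * partial ord0 phi x)) + phi x ^+ 2)); last first.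
  move=> x _; rewrite (partialM _ x sX (smoothM sp sp)) (partialM _ x sp sp) dX.
  by ring.
rewrite (RintegralZD mO); [|exact: sqi_mul mO _ _ L2p L2q|by case: L2p].
move=> E.
have := cauchy_schwarz mO L2p L2q.
set J := \int[mu]_(x in Omega) (phi x * _) in E *.
rewrite -/(L2norm phi) -/(L2norm (fun x => X x * partial ord0 phi x)) => CS.
have sqp : L2norm phi ^+ 2 = \int[mu]_(x in Omega) (phi x ^+ 2).
  by rewrite sqr_sqrtr// Rintegral_ge0// => x _; exact: sqr_ge0.
rewrite -sqp in E.
have Xle : L2norm (fun x => X x * partial ord0 phi x) <= M * field_norm Omega (gradient phi).
  have G0 := field_norm_ge0 Omega (gradient phi).
  apply: le_trans (_ : M * L2norm (partial ord0 phi) <= _); last first.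
    rewrite ler_wpM2l//; have := coord_norm_le mO ord0 (test_function_field_L2 tp).
    by under eq_Rintegral do rewrite gradientE.
  have n0 : 0 <= M * L2norm (partial ord0 phi) by rewrite mulr_ge0// L2norm_ge0.
  have [_ jq] := test_function_sqi tq.
  have [_ jXq] := L2q.
  rewrite -[leRHS]ger0_norm// -sqrtr_sqr ler_sqrt ?sqr_ge0// exprMn sqr_sqrtr; last first.
    by rewrite Rintegral_ge0// => x _; exact: sqr_ge0.
  rewrite -(RintegralZl _ mO jq); apply: le_Rintegral => //; first exact: mO.
    by apply: integrable_mulc => //; exact: mO.
  move=> x /OM /(_ ord0); rewrite mxE subr0 => xM.
  rewrite exprMn ler_wpM2r ?sqr_ge0// -[X x ^+ 2]real_normK ?num_real//.
  by rewrite ler_sqr ?nnegrE.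
move: CS E; rewrite ler_norml => /andP[CS _] E.
have p0 := L2norm_ge0 phi.
have [->|pn0] := eqVneq (L2norm phi) 0.
  by rewrite !mulr_ge0// field_norm_ge0.
have pp : 0 < L2norm phi by rewrite lt_neqAle eq_sym pn0.
rewrite -(ler_pM2l pp) -expr2.
have : L2norm phi * L2norm (fun x => X x * partial ord0 phi x) <=
  L2norm phi * (M * field_norm Omega (gradient phi)) by rewrite ler_wpM2l.
by move=> h; lra.
Qed.

End sobolev_bounded.

(** * The space H10 *)

Section weak_solutions.
Context {R : realType} {n : nat}.
Variables (Omega : set 'rV[R]_n.+1) (M : R).
Hypothesis oO : open Omega.
Hypothesis M0 : 0 <= M.
Hypothesis OM : Omega `<=` ccube 0 M.
Local Notation mu := (lebesgue_rV n.+1).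
Local Notation L2 := (square_integrable mu Omega).
Local Notation mO := (bounded_open_measurable oO).
Local Notation Ofin := (bounded_open_lty oO OM).
Local Notation L2n := (L2norm Omega).
Local Notation fn := (field_norm Omega).
Implicit Types (f g phi psi : 'rV[R]_n.+1 -> R) (u v w : sobolev_pair R n.+1).

Lemma field_L2B (a b : 'rV[R]_n.+1 -> 'rV[R]_n.+1) :
  field_L2 Omega a -> field_L2 Omega b -> field_L2 Omega (a - b).
Proof. by move=> sa sb; exact: (form_domB (energy1_form mO) sa sb). Qed.

Lemma cvg0_EFin (e : nat -> R) : (e k)%:E @[k --> \oo] --> 0%E <-> e @ \oo --> 0.
Proof.
split=> [/fine_cvg|e0]; first by [].
by apply: cvg_EFin => //; exact: nearW.
Qed.

Lemma H10P w : H10 Omega w <->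
  [/\ L2 w.1, field_L2 Omega w.2, weak_gradient Omega w.1 w.2 &
   exists phi : nat -> 'rV[R]_n.+1 -> R, [/\ forall k, test_function Omega (phi k),
     (fun k => L2n (w.1 - phi k)) @ \oo --> 0 &
     (fun k => fn (w.2 - gradient (phi k))) @ \oo --> 0]].
Proof.
have E1 (phi : nat -> 'rV[R]_n.+1 -> R) : (forall k, test_function Omega (phi k)) -> L2 w.1 ->
    (fun k => Lp_norm Omega 2%:E (fun x => w.1 x - phi k x)) =
    (fun k => (L2n (w.1 - phi k))%:E).
  move=> tp sw; apply/funext => k; rewrite (Lp_norm2E mO)//.
  by case: (sqiB mO sw (test_function_sqi oO OM (tp k))).
have E2 (phi : nat -> 'rV[R]_n.+1 -> R) : (forall k, test_function Omega (phi k)) ->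
    field_L2 Omega w.2 ->
    (fun k => Lp_norm Omega 2%:E (fun x => enorm (w.2 x - gradient (phi k) x))) =
    (fun k => (fn (w.2 - gradient (phi k)))%:E).
  move=> tp sw; apply/funext => k; rewrite -(Lp_norm_enorm mO)//.
  exact: field_L2B (test_function_field_L2 oO OM (tp k)).
split=> [[[L1 LG wg] [phi [tp c1 c2]]]|[L1 LG wg [phi [tp c1 c2]]]].
  have {}L1 : L2 w.1 by exact/(Lp2P mO).
  have {}LG : field_L2 Omega w.2 by move=> i; exact/(Lp2P mO).
  split => //; exists phi; split => //; apply/cvg0_EFin.
    by rewrite -E1.
  by rewrite -E2.
split.
  by split => // [|i]; exact/(Lp2P mO).
exists phi; split => //.
  by rewrite E1//; apply/cvg0_EFin.
by rewrite E2//; apply/cvg0_EFin.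
Qed.

Lemma gradient_lin c phi psi : smooth phi -> smooth psi ->
  gradient (c *: phi + psi) = c *: gradient phi + gradient psi.
Proof.
move=> sp sq; apply/funext => x; apply/rowP => i; rewrite !mxE.
by rewrite (partialD i x (smoothM (smooth_cst c) sp) sq) (partialZ c i x sp).
Qed.

Lemma test_function_lin c phi psi : test_function Omega phi -> test_function Omega psi ->
  test_function Omega (c *: phi + psi).
Proof.
move=> tp tq; apply: (@test_functionD _ _ _ (fun x => c * phi x)) => //.
by apply: test_functionM => //; exact: smooth_cst.
Qed.

Lemma test_function0 : test_function Omega 0.
Proof.
(* The closed cube of radius -1 is empty. *)
apply: (@test_function_ccube _ _ _ _ 0 (-1)) => [x /(_ ord0)||x].
- by move=> /(le_trans (normr_ge0 _)); rewrite lerNr oppr0 ler10.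
- exact: smooth_cst.
- by rewrite eqxx.
Qed.

Lemma gradient0 : gradient (0 : 'rV[R]_n.+1 -> R) = 0.
Proof. by apply/funext => x; apply/rowP => i; rewrite !mxE partial_cst. Qed.

Lemma test_function_H10 phi : test_function Omega phi -> H10 Omega (phi, gradient phi).
Proof.
move=> tp; apply/H10P; split => //=.
- exact: (test_function_sqi oO OM tp).
- exact: (test_function_field_L2 oO OM tp).
- exact: (test_function_weak_gradient oO OM tp).
- exists (fun=> phi); split => //.
    under eq_fun do rewrite subrr.
    rewrite (_ : L2n 0 = 0); first exact: cvg_cst.
    rewrite /L2norm (@eq_Rintegral _ _ _ mu Omega (fun=> 0)) ?Rintegral_cst ?mul0r ?sqrtr0//.
      exact: mO.
    by move=> x _; rewrite expr0n.
  under eq_fun do rewrite subrr.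
  rewrite (_ : fn 0 = 0); first exact: cvg_cst.
  rewrite /field_norm /energy (@eq_Rintegral _ _ _ mu Omega (fun=> 0)) ?Rintegral_cst ?mul0r ?sqrtr0//.
    exact: mO.
  by move=> x _; rewrite mul1r; apply: big1 => i _; rewrite mxE mul0r.
Qed.

Lemma weak_gradient_lin c u v : L2 u.1 -> field_L2 Omega u.2 -> L2 v.1 -> field_L2 Omega v.2 ->
  weak_gradient Omega u.1 u.2 -> weak_gradient Omega v.1 v.2 ->
  weak_gradient Omega (c *: u + v).1 (c *: u + v).2.
Proof.
move=> su sgu sv sgv wu wv i psi tq.
have s1 := test_function_sqi oO OM (test_function_partial i tq).
have s2 := test_function_sqi oO OM tq.
rewrite (@eq_Rintegral _ _ _ mu Omega (fun x => c * (u.1 x * partial i psi x) + v.1 x * partial i psi x)); last first.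
  by move=> x _; rewrite mulrA -mulrDl.
rewrite (RintegralZD mO); [|by apply: (sqi_mul mO)|by apply: (sqi_mul mO)].
rewrite wu// wv// [in RHS](@eq_Rintegral _ _ _ mu Omega (fun x => c * (u.2 x 0 i * psi x) + v.2 x 0 i * psi x)); last first.
  by move=> x _; rewrite -[(c *: u + v).2]/(c *: u.2 + v.2) !mxE mulrA -mulrDl.
rewrite (RintegralZD mO); [|by apply: (sqi_mul mO)|by apply: (sqi_mul mO)].
by rewrite opprD mulrN.
Qed.

Lemma H10D c u v : H10 Omega u -> H10 Omega v -> H10 Omega (c *: u + v).
Proof.
move=> /H10P[su sgu wu [phi [tp cp1 cp2]]] /H10P[sv sgv wv [psi [tq cq1 cq2]]].
apply/H10P; split.
- exact: (sqiZD mO c su sv).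
- exact: (field_L2D mO c sgu sgv).
- exact: weak_gradient_lin.
exists (fun k => c *: phi k + psi k); split.
- by move=> k; exact: test_function_lin.
- have lim0 : (fun k => `|c| * L2n (u.1 - phi k) + L2n (v.1 - psi k)) @ \oo --> (0 : R).
    rewrite -[X in _ --> X](_ : `|c| * 0 + 0 = 0); last by rewrite mulr0 addr0.
    exact: (cvgD (cvgM (cvg_cst _) cp1) cq1).
  apply: (squeeze_cvgr _ (cvg_cst (0 : R)) lim0).
  apply: nearW => k; rewrite L2norm_ge0/=.
  have -> : (c *: u + v).1 - (c *: phi k + psi k) = c *: (u.1 - phi k) + (v.1 - psi k).
    by apply/funext => x; rewrite /= scalerBr opprD addrACA.
  apply: (L2_norm_lin mO c (f := u.1 - phi k) (g := v.1 - psi k)).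
    exact: sqiB mO _ _ su (test_function_sqi oO OM (tp k)).
  exact: sqiB mO _ _ sv (test_function_sqi oO OM (tq k)).
- have lim0 : (fun k => `|c| * fn (u.2 - gradient (phi k)) + fn (v.2 - gradient (psi k))) @ \oo --> (0 : R).
    rewrite -[X in _ --> X](_ : `|c| * 0 + 0 = 0); last by rewrite mulr0 addr0.
    exact: (cvgD (cvgM (cvg_cst _) cp2) cq2).
  apply: (squeeze_cvgr _ (cvg_cst (0 : R)) lim0).
  apply: nearW => k; rewrite field_norm_ge0/=.
  rewrite gradient_lin; [|exact: test_function_smooth (tp k)|exact: test_function_smooth (tq k)].
  have -> : (c *: u + v).2 - (c *: gradient (phi k) + gradient (psi k)) =
      c *: (u.2 - gradient (phi k)) + (v.2 - gradient (psi k)).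
    by rewrite scalerBr opprD addrACA.
  apply: (field_norm_lin mO c).
    exact: field_L2B sgu (test_function_field_L2 oO OM (tp k)).
  exact: field_L2B sgv (test_function_field_L2 oO OM (tq k)).
Qed.

Lemma H10_field_L2 w : H10 Omega w -> field_L2 Omega w.2.
Proof. by move=> /H10P[]. Qed.

Lemma H10_normE w : H10 Omega w -> H10_norm Omega w = (fn w.2)%:E.
Proof. by move=> Hw; rewrite /H10_norm (Lp_norm_enorm mO)//; exact: H10_field_L2. Qed.

End weak_solutions.

(** * Existence of weak solutions *)

Section limits.
Context {R : realType}.

Lemma le_of_eq (a b : R) : a = b -> a <= b.
Proof. by move=> ->. Qed.

Lemma eq0_of_le_cvg0 (e : nat -> R) (c x : R) :
  e @ \oo --> 0 -> (forall k, `|x| <= c * e k) -> x = 0.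
Proof.
move=> e0 xe; apply/eqP; rewrite -normr_le0.
have ce : (fun k => c * e k) @ \oo --> 0.
  by rewrite -[X in _ --> X](mulr0 c); exact: (cvgM (cvg_cst _) e0).
rewrite -(cvg_lim _ ce)//; apply: limr_ge; first by apply/cvg_ex; exists 0.
exact: nearW.
Qed.

Lemma cvg_half_pow : (fun k => 2 ^- k : R) @ \oo --> 0.
Proof.
under eq_fun do rewrite -exprVn.
by apply: cvg_expr; rewrite ger0_norm ?invr_ge0// invf_lt1// ltr1n.
Qed.

Lemma squeeze_cvg0 (e h : nat -> R) (c : R) : e @ \oo --> 0 ->
  (forall k, 0 <= h k <= c * e k) -> h @ \oo --> 0.
Proof.
move=> e0 he; apply: (squeeze_cvgr _ (cvg_cst (0 : R))); last first.
  rewrite -[X in _ --> X](mulr0 c); exact: (cvgM (cvg_cst _) e0).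
exact: nearW.
Qed.

End limits.

Section existence.
Context {R : realType} {n : nat}.
Variables (Omega : set 'rV[R]_n.+1) (M : R).
Hypothesis oO : open Omega.
Hypothesis M0 : 0 <= M.
Hypothesis OM : Omega `<=` ccube 0 M.
Local Notation mu := (lebesgue_rV n.+1).
Local Notation L2 := (square_integrable mu Omega).
Local Notation mO := (bounded_open_measurable oO).
Local Notation Ofin := (bounded_open_lty oO OM).
Local Notation L2n := (L2norm Omega).
Local Notation fn := (field_norm Omega).
Local Notation tsqi := (test_function_sqi oO OM).
Local Notation tfield := (test_function_field_L2 oO OM).
Implicit Types (phi psi : 'rV[R]_n.+1 -> R) (u v w : sobolev_pair R n.+1).

Lemma Hm1_bound f : Hm1 Omega f ->
  exists2 C, 0 <= C & forall v, H10 Omega v -> `|f v| <= C * fn v.2.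
Proof.
move=> [_ [C fC]]; exists `|C| => // v Hv.
have := fC v Hv; rewrite (H10_normE oO OM Hv) -EFinM lee_fin => h.
by apply: (le_trans h); rewrite ler_wpM2r ?field_norm_ge0// ler_norm.
Qed.

Lemma Hm1B f u v : Hm1 Omega f -> H10 Omega u -> H10 Omega v -> f (u - v) = f u - f v.
Proof.
move=> [flin _] Hu Hv; have := flin (-1) v u Hv Hu.
by rewrite scaleN1r addrC => ->; rewrite mulN1r addrC.
Qed.

(** A sequence of test functions whose gradients are rapidly Cauchy converges in
    [H10]: by the Poincare inequality the functions converge as well. *)
Lemma H10_complete (phi : nat -> 'rV[R]_n.+1 -> R) (C : R) :
  (forall k, test_function Omega (phi k)) ->
  (forall k l, (k <= l)%N -> fn (gradient (phi k) - gradient (phi l)) <= C * 2 ^- k) ->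
  exists2 w, H10 Omega w & (fun k => fn (w.2 - gradient (phi k))) @ \oo --> 0.
Proof.
move=> tp dC.
have gB k l : gradient (phi k) - gradient (phi l) = gradient ((-1) *: phi l + phi k).
  rewrite (gradient_lin (-1) (test_function_smooth (tp l)) (test_function_smooth (tp k))).
  by rewrite addrC; congr (_ + _); exact: esym (scaleN1r _).
have tB k l : test_function Omega ((-1) *: phi l + phi k) by exact: test_function_lin.
have [h [sh hC]] : exists h, L2 h /\ forall k, L2n (phi k - h) <= (2 * M * C) * 2 ^- k.
  apply: (riesz_fischer mO Ofin) => [k|k l kl]; first exact: tsqi.
  apply: (@le_trans _ _ (L2n ((-1) *: phi l + phi k))).
    apply: le_of_eq; congr Num.sqrt; apply: eq_Rintegral => x _; congr (_ ^+ 2).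
    by rewrite addrC -[RHS]/(-1 * phi l x + phi k x) mulN1r.
  apply: le_trans (poincare oO M0 OM (tB k l)) _.
  by rewrite -gB -[leRHS]mulrA ler_wpM2l ?mulr_ge0// dC.
have /choice[G GP] : forall i, exists g, L2 g /\
    forall k, L2n (partial i (phi k) - g) <= C * 2 ^- k.
  move=> i; apply: (riesz_fischer mO Ofin) => [k|k l kl].
    exact/tsqi/test_function_partial.
  apply: le_trans (dC k l kl); apply: le_trans (coord_norm_le mO i _); last first.
    exact: (field_L2B oO (tfield (tp k)) (tfield (tp l))).
  apply: le_of_eq; congr Num.sqrt; apply: eq_Rintegral => x _.
  by rewrite !mxE.
pose w : sobolev_pair R n.+1 := (h, fun x => \row_i G i x).
have sw2 : field_L2 Omega w.2.
  by move=> i; under eq_fun do rewrite mxE; case: (GP i).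
have dw k : fn (w.2 - gradient (phi k)) <= Num.sqrt n.+1%:R * C * 2 ^- k.
  have Ck0 : 0 <= C * 2 ^- k by have [_ /(_ k)] := GP ord0; apply: le_trans; exact: L2norm_ge0.
  have r0 : 0 <= Num.sqrt n.+1%:R * C * 2 ^- k by rewrite -mulrA mulr_ge0// sqrtr_ge0.
  rewrite -(ler_sqr (field_norm_ge0 _ _) r0) (field_norm_sum mO); last first.
    exact: (field_L2B oO sw2 (tfield (tp k))).
  rewrite -[X in _ <= X ^+ 2]mulrA exprMn sqr_sqrtr// -[X in X%:R]card_ord mulr_natl -sumr_const.
  apply: ler_sum => i _; have [_ /(_ k)] := GP i.
  rewrite -(ler_sqr (L2norm_ge0 _ _) Ck0) sqr_sqrtr; last first.
    by rewrite Rintegral_ge0// => x _; exact: sqr_ge0.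
  apply: le_trans; apply: le_of_eq; apply: eq_Rintegral => x _.
  by rewrite !mxE -[LHS]sqrrN opprB.
have cw : (fun k => fn (w.2 - gradient (phi k))) @ \oo --> 0.
  by apply: (squeeze_cvg0 cvg_half_pow) => k; rewrite field_norm_ge0; exact: dw.
exists w => //; apply/(H10P oO OM); split => //.
- move=> i psi tq.
  have [sGi GiC] := GP i.
  have tqi := test_function_partial i tq.
  have j1 g q : L2 g -> test_function Omega q ->
      mu.-integrable Omega (EFin \o (fun x => g x * q x)).
    by move=> sg tq'; apply: (sqi_mul mO) => //; exact: tsqi.
  apply/eqP; rewrite -addr_eq0; apply/eqP.
  have E : \int[mu]_(x in Omega) (w.2 x 0 i * psi x) = \int[mu]_(x in Omega) (G i x * psi x).
    by apply: eq_Rintegral => x _; rewrite mxE.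
  rewrite {}E.
  apply: (@eq0_of_le_cvg0 _ _ (2 * M * C * L2n (partial i psi) + C * L2n psi) _ cvg_half_pow).
  move=> k.
  have wg := test_function_weak_gradient oO OM (tp k) i tq.
  have E1 : \int[mu]_(x in Omega) (h x * partial i psi x) =
      \int[mu]_(x in Omega) (phi k x * partial i psi x) -
      \int[mu]_(x in Omega) ((phi k x - h x) * partial i psi x).
    rewrite -RintegralB//; first last.
    + apply: j1 => //; exact: (sqiB mO (tsqi (tp k)) sh).
    + apply: j1 => //; exact: tsqi.
    + exact: mO.
    by apply: eq_Rintegral => x _; rewrite mulrBl opprB addrC subrK.
  have E2 : \int[mu]_(x in Omega) (G i x * psi x) =
      \int[mu]_(x in Omega) (gradient (phi k) x 0 i * psi x) -
      \int[mu]_(x in Omega) ((partial i (phi k) x - G i x) * psi x).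
    under [X in _ = X - _]eq_Rintegral do rewrite gradientE.
    rewrite -RintegralB//; first last.
    + apply: j1 => //; exact: (sqiB mO (tsqi (test_function_partial i (tp k))) sGi).
    + by apply: j1 => //; exact/tsqi/test_function_partial.
    + exact: mO.
    by apply: eq_Rintegral => x _; rewrite mulrBl opprB addrC subrK.
  rewrite E1 E2 wg addrACA addNr add0r -opprD normrN mulrDl (le_trans (ler_normD _ _))//.
  have S1 := sqiB mO (tsqi (tp k)) sh.
  have S2 := sqiB mO (tsqi (test_function_partial i (tp k))) sGi.
  apply: lerD.
    apply: le_trans (cauchy_schwarz mO S1 (tsqi tqi)) _.
    by rewrite mulrAC ler_wpM2r ?sqrtr_ge0//; exact: hC.
  apply: le_trans (cauchy_schwarz mO S2 (tsqi tq)) _.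
  by rewrite mulrAC ler_wpM2r ?sqrtr_ge0//; exact: GiC.
- exists phi; split => //.
  apply: (squeeze_cvg0 (c := 2 * M * C) cvg_half_pow) => k; rewrite L2norm_ge0/=.
  apply: le_trans (hC k); apply: le_of_eq; congr Num.sqrt; apply: eq_Rintegral => x _.
  by rewrite -[LHS]sqrrN opprB.
Qed.

(** The Lax-Milgram theorem for a symmetric form: the approximate representatives of
    [f] among test functions have a Cauchy sequence of gradients, hence converge in
    [H10]; the equation passes to the limit against test functions, and then holds
    against [H10] by density. *)
Lemma exists_weak_solution a K s f : bounded_coef Omega a K -> 0 < s ->
  (forall x, s <= a x) -> Hm1 Omega f -> exists w, weak_solution Omega a f w.
Proof.
move=> aK s0 sa Hf; have [flin _] := Hf; have [C C0 fC] := Hm1_bound Hf.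
have a0 x : 0 <= a x by apply: le_trans (sa x); exact: ltW.
have EF := energy_form mO aK a0.
pose S : set (sobolev_pair R n.+1) :=
  [set p | exists2 phi, test_function Omega phi & p = (phi, gradient phi)].
pose B u v := energy Omega a u.2 v.2.
have SH p : S p -> H10 Omega p by move=> [phi tp ->]; exact: (test_function_H10 oO OM).
have SF p : S p -> field_L2 Omega p.2 by move=> /SH; exact: (H10_field_L2 oO OM).
have HB : psd_form S B.
  split.
  - by exists 0; [exact: test_function0|rewrite gradient0].
  - move=> c u v [phi tp ->] [psi tq ->]; exists (c *: phi + psi).
      exact: test_function_lin.
    by rewrite gradient_lin//; [exact: (test_function_smooth tp)|exact: (test_function_smooth tq)].
  - by move=> u v Su Sv; apply: (form_sym EF); exact: SF.
  - by move=> c u v w Su Sv Sw; apply: (form_lin EF); exact: SF.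
  - by move=> u Su; apply: (form_ge0 EF); exact: SF.
have sq0 : 0 < Num.sqrt s by rewrite sqrtr_gt0.
have fnB g : field_L2 Omega g -> fn g <= (Num.sqrt s)^-1 * Num.sqrt (energy Omega a g g).
  move=> sg; rewrite -ler_pdivrMl ?invr_gt0// invrK.
  rewrite -[leLHS]ger0_norm ?mulr_ge0 ?field_norm_ge0 ?sqrtr_ge0// -sqrtr_sqr.
  rewrite ler_sqrt; last exact: form_ge0 EF _ sg.
  by rewrite exprMn (sqr_sqrtr (ltW s0)); exact: (energy_coercive mO aK sa sg).
have [v [Sv vB vC]] := approximate_riesz HB (f := f) (C := C * (Num.sqrt s)^-1)
  (fun c u v Su Sv => flin c u v (SH u Su) (SH v Sv))
  (fun u Su => ltac:(rewrite -mulrA; exact: le_trans (fC u (SH u Su)) (ler_wpM2l C0 (fnB _ (SF u Su))))).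
have /choice[phi phiP] : forall k, exists phi, test_function Omega phi /\ v k = (phi, gradient phi).
  by move=> k; have [phi tp E] := Sv k; exists phi.
have tp k : test_function Omega (phi k) by case: (phiP k).
have vE k : v k = (phi k, gradient (phi k)) by case: (phiP k).
have [w Hw cw] : exists2 w, H10 Omega w & (fun k => fn (w.2 - gradient (phi k))) @ \oo --> 0.
  apply: (H10_complete (C := (Num.sqrt s)^-1 * 2) tp) => k l kl.
  apply: le_trans (fnB _ (field_L2B oO (tfield (tp k)) (tfield (tp l)))) _.
  rewrite -mulrA ler_wpM2l ?invr_ge0 ?sqrtr_ge0//.
  have := vC k l; rewrite !vE => /le_trans; apply.
  rewrite mulr_natl mulr2n lerD2l lef_pV2 ?posrE ?exprn_gt0//.
  by rewrite ler_eXn2l ?ltrDl ?ltr01.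
exists w; split => //.
have key p : S p -> energy Omega a w.2 p.2 = f p.
  move=> Sp; apply/eqP; rewrite -subr_eq0; apply/eqP.
  pose e k := fn (w.2 - gradient (phi k)) + 2 ^- k.
  have e0 : e @ \oo --> 0.
    by rewrite -[X in _ --> X](addr0 0); exact: (cvgD cw cvg_half_pow).
  apply: (@eq0_of_le_cvg0 _ e (K * fn p.2 + Num.sqrt (B p p)) _ e0) => k.
  have -> : energy Omega a w.2 p.2 - f p =
      energy Omega a (w.2 - gradient (phi k)) p.2 + (B (v k) p - f p).
    have := form_linB EF (H10_field_L2 oO OM Hw) (tfield (tp k)) (SF p Sp).
    by rewrite /B vE => ->; rewrite addrA subrK.
  apply: le_trans (ler_normD _ _) _.
  have h1 : `|energy Omega a (w.2 - gradient (phi k)) p.2| <= K * (fn (w.2 - gradient (phi k)) * fn p.2).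
    apply: energy_bound => //; [exact: mO| |exact: SF].
    exact: (field_L2B oO (H10_field_L2 oO OM Hw) (tfield (tp k))).
  have h2 := vB k p Sp.
  have K0 : 0 <= K by case: aK => _ /(_ 0); exact: le_trans.
  have n1 := field_norm_ge0 Omega (w.2 - gradient (phi k)).
  have n2 := field_norm_ge0 Omega p.2.
  have n3 := sqrtr_ge0 (B p p).
  have n4 : 0 <= 2 ^- k :> R by rewrite invr_ge0 exprn_ge0.
  apply: le_trans (lerD h1 h2) _; rewrite /e.
  have m1 := mulr_ge0 n3 n1; have m2 := mulr_ge0 (mulr_ge0 K0 n2) n4.
  by lra.
move=> p Hp; have [_ sp _ [psi [tq _ cq]]] := (H10P oO OM p).1 Hp.
rewrite -/(energy Omega a w.2 p.2); apply/eqP; rewrite -subr_eq0; apply/eqP.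
apply: (@eq0_of_le_cvg0 _ _ (K * fn w.2 + C) _ cq) => k.
have Hk := test_function_H10 oO OM (tq k).
have -> : energy Omega a w.2 p.2 - f p =
    energy Omega a w.2 (p.2 - gradient (psi k)) - f (p - (psi k, gradient (psi k))).
  have Ek : energy Omega a w.2 (gradient (psi k)) = f (psi k, gradient (psi k)).
    by apply: (key (psi k, gradient (psi k))); exists (psi k).
  rewrite (Hm1B Hf Hp Hk) -Ek.
  have sw := H10_field_L2 oO OM Hw.
  rewrite (form_sym EF sw (field_L2B oO sp (tfield (tq k)))) (form_linB EF sp (tfield (tq k)) sw).
  by rewrite (form_sym EF sp sw) (form_sym EF (tfield (tq k)) sw)/=; ring.
have HB' : H10 Omega (p - (psi k, gradient (psi k))).
  by have := H10D oO OM (-1) Hk Hp; rewrite scaleN1r addrC.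
apply: le_trans (ler_normB _ _) _; rewrite mulrDl; apply: lerD; last exact: fC HB'.
rewrite -mulrA; apply: energy_bound => //; first exact: mO.
  exact: (H10_field_L2 oO OM Hw).
exact: (field_L2B oO sp (tfield (tq k))).
Qed.

End existence.

(** * Bounds on the difference of the resolvents *)

Section ess_bounds.
Context {R : realType} {n : nat}.
Variable Omega : set 'rV[R]_n.
Hypothesis mO : measurable Omega.
Local Notation mu := (lebesgue_rV n).

Lemma Lp_normy_ae (g : 'rV[R]_n -> R) K : Lp_norm Omega +oo g = K%:E ->
  {ae mu, forall x, Omega x -> `|g x| <= K}.
Proof.
rewrite /Lp_norm unlock /Lnorm; case: ifPn => [_ EK|mu0 _].
  have := ess_sup_ge mu (abse \o (EFin \o (g \_ Omega))); rewrite EK.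
  apply: filterS => x /= + Ox.
  by rewrite patchE ifT ?inE// lee_fin.
exists setT; split => //; apply/eqP; rewrite eq_le measure_ge0 andbT.
by rewrite leNgt.
Qed.

Lemma ae_Lp_normy (g : 'rV[R]_n -> R) K : 0 <= K ->
  {ae mu, forall x, Omega x -> `|g x| <= K} -> (Lp_norm Omega +oo g <= K%:E)%E.
Proof.
move=> K0 gK; rewrite /Lp_norm unlock /Lnorm; case: ifPn => [_|_]; last by rewrite lee_fin.
apply/ess_supP; apply: filterS gK => x /= gK.
rewrite patchE; case: ifPn => [/[1!inE] Ox|_]; first by rewrite lee_fin gK.
by rewrite normr0 lee_fin.
Qed.

Lemma energy_ae (a b : 'rV[R]_n -> R) u v :
  measurable_fun Omega a -> measurable_fun Omega b ->
  field_L2 Omega u -> field_L2 Omega v ->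
  {ae mu, forall x, Omega x -> a x = b x} -> energy Omega a u v = energy Omega b u v.
Proof.
move=> ma mb su sv ab; congr fine.
have md : measurable_fun Omega (fun x => dotr (u x) (v x)).
  have /(measurable_int mu)/measurable_EFinP := integrable_energy mO (bounded_coef_cst Omega 1) su sv.
  by under eq_fun do rewrite mul1r.
apply: ae_eq_integral => //; try by apply/measurable_EFinP; exact: measurable_funM.
by apply: filterS ab => x /= abx Ox; rewrite abx.
Qed.

(** Truncation does not change the class of a coefficient that obeys the bounds almost
    everywhere. *)
Definition clip (s t : R) (a : 'rV[R]_n -> R) x := Num.max s (Num.min t (a x)).

Lemma clip_bounds s t a x : s <= t -> s <= clip s t a x <= t.
Proof. by move=> st; rewrite /clip le_max lexx/= ge_max st ge_min lexx. Qed.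

Lemma clipE s t a x : s <= a x <= t -> clip s t a x = a x.
Proof. by move=> /andP[sa at_]; rewrite /clip min_r// max_r. Qed.

Lemma measurable_clip s t a : measurable_fun Omega a -> measurable_fun Omega (clip s t a).
Proof.
move=> ma; apply: measurable_maxr; first exact: measurable_cst.
by apply: measurable_minr => //; exact: measurable_cst.
Qed.

Lemma energy_ae_bound (d : 'rV[R]_n -> R) K u v : 0 <= K ->
  measurable_fun Omega d -> field_L2 Omega u -> field_L2 Omega v ->
  {ae mu, forall x, Omega x -> `|d x| <= K} ->
  `|energy Omega d u v| <= K * (field_norm Omega u * field_norm Omega v).
Proof.
move=> K0 md su sv dK.
have mc := measurable_clip (- K) K md.
rewrite (energy_ae md mc su sv); last first.
  by apply: filterS dK => x h Ox; rewrite clipE// -ler_norml h.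
apply: energy_bound => //; split => // x.
by rewrite ler_norml clip_bounds// (le_trans _ K0)// oppr_le0.
Qed.

End ess_bounds.

Section resolvents.
Context {R : realType} {n : nat}.
Variables (Omega : set 'rV[R]_n.+1) (M : R).
Hypothesis oO : open Omega.
Hypothesis M0 : 0 <= M.
Hypothesis OM : Omega `<=` ccube 0 M.
Local Notation mu := (lebesgue_rV n.+1).
Local Notation mO := (bounded_open_measurable oO).
Local Notation fn := (field_norm Omega).
Local Notation tfield := (test_function_field_L2 oO OM).
Local Notation H10F := (H10_field_L2 oO OM).
Implicit Types (u v w : sobolev_pair R n.+1).

Lemma admissible_clip (s0 s1 : R) sigma : s0 <= s1 -> admissible Omega s0 s1 sigma ->
  measurable_fun Omega sigma /\
  {ae mu, forall x, Omega x -> sigma x = clip s0 s1 sigma x}.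
Proof.
move=> s01 [sL sb]; split.
  have : sigma \_ Omega \in @mfun _ _ _ R by exact: sub_Lfun_mfun sL.
  by rewrite inE/= => ms; apply/measurable_restrictT => //; exact: mO.
by apply: filterS sb => x h Ox; rewrite clipE// h.
Qed.

Lemma weak_solution_ae (a b : 'rV[R]_n.+1 -> R) f :
  measurable_fun Omega a -> measurable_fun Omega b ->
  {ae mu, forall x, Omega x -> a x = b x} ->
  weak_solution Omega a f = weak_solution Omega b f.
Proof.
move=> ma mb ab; apply/seteqP; split=> u [Hu uf]; split => // v Hv.
  by rewrite -uf//; apply/esym; apply: (energy_ae mO) => //; exact: H10F.
by rewrite -uf//; apply: (energy_ae mO) => //; exact: H10F.
Qed.

Lemma H10_0 : H10 Omega (0 : sobolev_pair R n.+1).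
Proof.
by have := test_function_H10 oO OM (test_function0 Omega); rewrite gradient0.
Qed.

Lemma H10B u v : H10 Omega u -> H10 Omega v -> H10 Omega (u - v).
Proof. by move=> Hu Hv; have := H10D oO OM (-1) Hv Hu; rewrite scaleN1r addrC. Qed.

Lemma Hm1_le1 f v : Hm1 Omega f -> (Hm1_norm Omega f <= 1)%E -> H10 Omega v ->
  `|f v| <= fn v.2.
Proof.
move=> Hf f1 Hv; have [flin _] := Hf.
have [v0|vn0] := eqVneq (fn v.2) 0.
  by have [C _ fC] := Hm1_bound oO OM Hf; have := fC v Hv; rewrite v0 mulr0.
have vp : 0 < fn v.2 by rewrite lt_neqAle eq_sym vn0 field_norm_ge0.
have H0 := H10_0.
have f0 : f 0 = 0 by have := flin (-1) 0 0 H0 H0; rewrite scaler0 addr0; lra.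
pose c := (fn v.2)^-1.
have Hw : H10 Omega (c *: v + 0) by exact: H10D oO OM c _ _ Hv H0.
have wn : fn (c *: v + 0).2 <= 1.
  apply: (@le_trans _ _ (`|c| * fn v.2 + fn 0)).
    exact: (field_norm_lin mO c (H10F Hv) (H10F H0)).
  rewrite (_ : fn 0 = 0); last first.
    have := form_ge0 (energy1_form mO) (H10F H0); rewrite -(sqr_field_norm mO (H10F H0)).
    rewrite /field_norm /energy (@eq_Rintegral _ _ _ mu Omega (fun=> 0)) ?Rintegral_cst ?mul0r ?sqrtr0//.
      exact: mO.
    by move=> x _; rewrite mul1r; apply: big1 => i _; rewrite mxE mul0r.
  by rewrite addr0 ger0_norm ?invr_ge0 ?field_norm_ge0// mulVf.
have : (`|f (c *: v + 0)|%:E <= 1)%E.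
  apply: le_trans f1; apply: ereal_sup_ubound; exists (c *: v + 0) => //.
  by split => //; rewrite (H10_normE oO OM)// lee_fin.
rewrite flin// f0 addr0 lee_fin normrM ger0_norm ?invr_ge0 ?field_norm_ge0//.
by rewrite ler_pdivrMl// mulr1.
Qed.

Lemma energy_subl a b K L g h : bounded_coef Omega a K -> bounded_coef Omega b L ->
  field_L2 Omega g -> field_L2 Omega h ->
  energy Omega (fun x => a x - b x) g h = energy Omega a g h - energy Omega b g h.
Proof.
move=> aK bL su sv; rewrite /energy -RintegralB//; last first.
- exact: (integrable_energy mO bL su sv).
- exact: (integrable_energy mO aK su sv).
- exact: mO.
by apply: eq_Rintegral => x _; rewrite mulrBl.
Qed.

Variables (s0 s1 : R).
Hypothesis s0p : 0 < s0.
Hypothesis s01 : s0 <= s1.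

Definition elliptic_coef (a : 'rV[R]_n.+1 -> R) :=
  measurable_fun Omega a /\ forall x, s0 <= a x <= s1.

Lemma elliptic_coef_bounded a : elliptic_coef a -> bounded_coef Omega a s1.
Proof.
move=> [ma ab]; split => // x; have /andP[h1 h2] := ab x.
by rewrite ger0_norm// (le_trans (ltW s0p)).
Qed.

Lemma resolvent_spec a f : elliptic_coef a -> Hm1 Omega f ->
  H10 Omega (resolvent Omega a f) /\
  forall v, H10 Omega v -> energy Omega a (resolvent Omega a f).2 v.2 = f v.
Proof.
move=> na Hf.
have [w Hw] := exists_weak_solution oO M0 OM (elliptic_coef_bounded na) s0p
  (fun x => proj1 (andP (na.2 x))) Hf.
by have [] := @xgetPex _ 0 (weak_solution Omega a f) (ex_intro _ w Hw).
Qed.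

Local Notation diff_norm a b :=
  (Hm1_H10_norm Omega (fun f => resolvent Omega a f - resolvent Omega b f)).

(** Testing the difference [w] of the two solutions against itself, the common
    right-hand side cancels, and [s0 |Dw|^2 <= K |Du'| |Dw|]; testing the equation
    of [u'] against [u'] gives [s0 |Du'| <= 1]. *)
Lemma resolvent_diff_le a b K : elliptic_coef a -> elliptic_coef b -> 0 <= K ->
  {ae mu, forall x, Omega x -> `|a x - b x| <= K} ->
  ((s0 ^+ 2)%:E * diff_norm a b <= K%:E)%E.
Proof.
move=> na nb K0 abK.
have [aK bK] := (elliptic_coef_bounded na, elliptic_coef_bounded nb).
have s02 : 0 < s0 ^+ 2 by rewrite exprn_gt0.
suff h : (diff_norm a b <= (K / s0 ^+ 2)%:E)%E.
  apply: le_trans (lee_wpmul2l _ h) _; first by rewrite lee_fin ltW.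
  by rewrite -EFinM lee_fin mulrCA divff ?mulr1// gt_eqF.
apply: ge_ereal_sup => _ [f [Hf f1] <-].
have [Hu uE] := resolvent_spec na Hf; have [Hu' u'E] := resolvent_spec nb Hf.
set u := resolvent Omega a f in Hu uE *; set u' := resolvent Omega b f in Hu' u'E *.
have Hw := H10B Hu Hu'; rewrite (H10_normE oO OM Hw) lee_fin.
have [su su' sw] : [/\ field_L2 Omega u.2, field_L2 Omega u'.2 & field_L2 Omega (u - u').2].
  by split; exact: H10F.
have EF := energy_form mO aK (fun x => le_trans (ltW s0p) (proj1 (andP (na.2 x)))).
have E : energy Omega a (u - u').2 (u - u').2 = - energy Omega (fun x => a x - b x) u'.2 (u - u').2.
  rewrite (energy_subl aK bK su' sw) u'E// -uE//.
  have := form_linB EF su su' sw => /= ->; by rewrite opprB.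
have c1 := energy_coercive mO aK (fun x => proj1 (andP (na.2 x))) sw.
have c2 := energy_coercive mO bK (fun x => proj1 (andP (nb.2 x))) su'.
have md : measurable_fun Omega (fun x => a x - b x).
  by apply: measurable_funB; [case: na|case: nb].
have c3 := energy_ae_bound mO K0 md su' sw abK.
have c4 := Hm1_le1 Hf f1 Hu'.
rewrite u'E// in c2; rewrite E in c1.
move: c3; rewrite ler_norml => /andP[c3 _].
have n1 := field_norm_ge0 Omega (u - u').2; have n2 := field_norm_ge0 Omega u'.2.
set x := fn (u - u').2 in c1 c3 n1 *; set y := fn u'.2 in c2 c3 c4 n2 *.
have c5 : s0 * y <= 1.
  have [->|yn0] := eqVneq y 0; first by rewrite mulr0.
  have yp : 0 < y by rewrite lt_neqAle eq_sym yn0.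
  rewrite -(ler_pM2r yp) mul1r -mulrA -expr2.
  by apply: (le_trans c2); apply: le_trans c4; exact: ler_norm.
have c6 : s0 * x <= K * y.
  have [->|xn0] := eqVneq x 0; first by rewrite mulr0 mulr_ge0.
  have xp : 0 < x by rewrite lt_neqAle eq_sym xn0.
  rewrite -(ler_pM2r xp) -!mulrA -expr2; lra.
rewrite ler_pdivlMr// mulrC expr2 -mulrA.
apply: (@le_trans _ _ (s0 * (K * y))); first by rewrite ler_pM2l.
by rewrite mulrCA ler_piMr.
Qed.

(** At [f = A_a u] with [u = phi], the resolvents return [u] and some [w], and the
    energy of [a - b] at [u] is the integral of [b D(w - u) . Du]. The last hypothesis
    puts [f] in the unit ball of the dual space. *)
Lemma energy_diff_le a b N phi : elliptic_coef a -> elliptic_coef b -> test_function Omega phi ->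
  (diff_norm a b <= N%:E)%E -> s1 * fn (gradient phi) <= 1 ->
  `|energy Omega (fun x => a x - b x) (gradient phi) (gradient phi)| <=
  s1 * (N * fn (gradient phi)).
Proof.
move=> na nb tp dN small.
have [aK bK] := (elliptic_coef_bounded na, elliptic_coef_bounded nb).
have s1p : 0 < s1 by exact: lt_le_trans s01.
have EFa := energy_form mO aK (fun x => le_trans (ltW s0p) (proj1 (andP (na.2 x)))).
have EFb := energy_form mO bK (fun x => le_trans (ltW s0p) (proj1 (andP (nb.2 x)))).
pose u : sobolev_pair R n.+1 := (phi, gradient phi).
have Hu : H10 Omega u := test_function_H10 oO OM tp.
have su := H10F Hu.
pose f v := energy Omega a u.2 v.2.
have fb v : H10 Omega v -> `|f v| <= fn v.2.
  move=> Hv; apply: le_trans (energy_bound mO aK su (H10F Hv)) _.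
  by rewrite mulrA ler_piMl// field_norm_ge0.
have Hf : Hm1 Omega f.
  split.
    move=> c v w Hv Hw; have [sv sw] := (H10F Hv, H10F Hw).
    have slin := field_L2D mO c sv sw.
    rewrite /f (form_sym EFa su slin) (form_lin EFa c sv sw su).
    by rewrite (form_sym EFa sv su) (form_sym EFa sw su).
  exists 1 => v Hv; rewrite (H10_normE oO OM Hv) mul1e lee_fin; exact: fb.
have f1 : (Hm1_norm Omega f <= 1)%E.
  apply: ge_ereal_sup => _ [v [Hv v1] <-].
  apply: le_trans v1; rewrite (H10_normE oO OM Hv) lee_fin; exact: fb.
have [Hz zE] := resolvent_spec na Hf; have [Hw wE] := resolvent_spec nb Hf.
set z := resolvent Omega a f in Hz zE *; set w := resolvent Omega b f in Hw wE *.
have zw : fn (z - w).2 <= N.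
  rewrite -lee_fin -(H10_normE oO OM (H10B Hz Hw)); apply: le_trans dN.
  by apply: ereal_sup_ubound; exists f.
have [sz sw] := (H10F Hz, H10F Hw).
have zu : fn (z.2 - u.2) = 0.
  have Hzu := H10B Hz Hu; have szu := field_L2B oO sz su.
  have := energy_coercive mO aK (fun x => proj1 (andP (na.2 x))) szu.
  rewrite (form_linB EFa sz su szu) -/(f (z - u)) -[energy _ a z.2 _]/(energy Omega a z.2 (z - u).2).
  rewrite zE// subrr => h; apply/eqP; rewrite -sqrf_eq0.
  by rewrite eq_le sqr_ge0 andbT -(ler_pM2l s0p) mulr0.
have wu : fn (w.2 - u.2) <= N.
  have -> : w.2 - u.2 = (-1) *: (z - w).2 + (z.2 - u.2).
    by rewrite scaleN1r opprB addrA subrK.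
  apply: le_trans (field_norm_lin mO (-1) (H10F (H10B Hz Hw)) (field_L2B oO sz su)) _.
  by rewrite zu addr0 normrN1 mul1r.
rewrite (energy_subl aK bK su su) -[energy _ a _ _]/(f u) -(wE u Hu).
rewrite -(form_linB EFb sw su su).
apply: le_trans (energy_bound mO bK (field_L2B oO sw su) su) _.
by rewrite ler_pM2l// ler_wpM2r// field_norm_ge0.
Qed.

Lemma energy_diff_le_sqr a b N phi : elliptic_coef a -> elliptic_coef b -> test_function Omega phi ->
  (diff_norm a b <= N%:E)%E ->
  `|energy Omega (fun x => a x - b x) (gradient phi) (gradient phi)| <=
  s1 ^+ 2 * N * fn (gradient phi) ^+ 2.
Proof.
move=> na nb tp dN.
have s1p : 0 < s1 by exact: lt_le_trans s01.
have [aK bK] := (elliptic_coef_bounded na, elliptic_coef_bounded nb).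
have sg := tfield tp.
have dK : bounded_coef Omega (fun x => a x - b x) (s1 + s1).
  split; first by apply: measurable_funB; [case: na|case: nb].
  by move=> x; rewrite (le_trans (ler_normB _ _))// lerD//; [case: aK|case: bK].
have [g0|gn0] := eqVneq (fn (gradient phi)) 0.
  have := energy_bound mO dK sg sg; rewrite g0 !mulr0 => /le_trans; apply.
  by rewrite expr0n mulr0.
have gp : 0 < fn (gradient phi) by rewrite lt_neqAle eq_sym gn0 field_norm_ge0.
(* The scaling that gives [A_a (c phi)] a dual norm at most 1. *)
pose c := (s1 * fn (gradient phi))^-1.
have cp : 0 < c by rewrite invr_gt0 mulr_gt0.
have tc : test_function Omega (fun x => c * phi x).
  by apply: test_functionM => //; exact: smooth_cst.
have gc : gradient (fun x => c * phi x) = c *: gradient phi.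
  apply/funext => x; apply/rowP => i; rewrite !mxE partialZ//.
  exact: (test_function_smooth tp).
have quad e K : bounded_coef Omega e K -> energy Omega e (c *: gradient phi) (c *: gradient phi) =
    c ^+ 2 * energy Omega e (gradient phi) (gradient phi).
  move=> eK; rewrite /energy -RintegralZl//; last exact: (integrable_energy mO eK sg sg).
    apply: eq_Rintegral => x _; rewrite /dotr mulr_sumr [in RHS]mulr_sumr mulr_sumr.
    by apply: eq_bigr => i _; rewrite !mxE; ring.
  exact: mO.
have fc : fn (gradient (fun x => c * phi x)) = s1^-1.
  rewrite gc /field_norm (quad _ _ (bounded_coef_cst Omega 1)) -(sqr_field_norm mO sg).
  rewrite -exprMn sqrtr_sqr ger0_norm; last by rewrite mulr_ge0 ?field_norm_ge0// ltW.
  by rewrite /c; field; rewrite gn0 gt_eqF.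
have := energy_diff_le na nb tc dN; rewrite fc gc (quad _ _ dK) divff ?gt_eqF// => /(_ (lexx _)).
rewrite normrM ger0_norm ?sqr_ge0//.
rewrite [s1 * _]mulrCA divff ?gt_eqF// mulr1.
rewrite -ler_pdivlMl ?exprn_gt0// => h; apply: (le_trans h); apply: le_of_eq.
by rewrite /c; field; rewrite gn0 gt_eqF.
Qed.

End resolvents.

Lemma add_le_of_le_mul {R : realDomainType} (l A B D S C F q : R) :
  A <= l * S -> B <= l * C -> A + B + q * D <= l * (S + C - q * F) + q * (l * F + D).
Proof. by move=> hA hB; lra. Qed.

(** * Oscillating test functions *)

Section oscillation.
Context {R : realType} {n : nat}.
Variables (Omega : set 'rV[R]_n.+1) (M : R).
Hypothesis oO : open Omega.
Hypothesis OM : Omega `<=` ccube 0 M.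
Local Notation mu := (lebesgue_rV n.+1).
Local Notation mO := (bounded_open_measurable oO).
Local Notation fn := (field_norm Omega).
Local Notation tsqi := (test_function_sqi oO OM).
Local Notation tfield := (test_function_field_L2 oO OM).
Implicit Types (phi : 'rV[R]_n.+1 -> R) (c : R).

Definition sin_wave phi c (x : 'rV[R]_n.+1) := phi x * (c^-1 * sin (c * x 0 ord0)).
Definition cos_wave phi c (x : 'rV[R]_n.+1) := phi x * (c^-1 * cos (c * x 0 ord0)).

Lemma sin_wave_test phi c : test_function Omega phi -> test_function Omega (sin_wave phi c).
Proof.
move=> tp; rewrite /sin_wave; under eq_fun do rewrite mulrC; apply: test_functionM => //.
by apply: smoothM; [exact: smooth_cst|case: (smooth_sin_cos c (@ord0 n))].
Qed.

Lemma cos_wave_test phi c : test_function Omega phi -> test_function Omega (cos_wave phi c).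
Proof.
move=> tp; rewrite /cos_wave; under eq_fun do rewrite mulrC; apply: test_functionM => //.
by apply: smoothM; [exact: smooth_cst|case: (smooth_sin_cos c (@ord0 n))].
Qed.

Lemma partial_wave phi (h h' : R -> R) c i x : smooth phi ->
  smooth (fun y : 'rV[R]_n.+1 => h (c * y 0 ord0)) ->
  (forall t : R, is_derive t (1 : R) h (h' t)) -> c != 0 ->
  partial i (fun y => phi y * (c^-1 * h (c * y 0 ord0))) x =
  phi x * (if ord0 == i then h' (c * x 0 ord0) else 0) +
  c^-1 * h (c * x 0 ord0) * partial i phi x.
Proof.
move=> sp sh dh c0.
rewrite (partialM i x sp (smoothM (smooth_cst c^-1) sh)).
rewrite partialZ//; congr (_ * _ + _).
have dl : is_derive (x 0 ord0) (1 : R) (fun s : R => h (c * s)) (h' (c * x 0 ord0) * c).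
  apply: (@is_derive1_comp _ h (fun s => c * s)) => //.
  by apply: is_derive_eq (is_deriveZ _ _) _; rewrite [_ *: _]mulr1.
have [_ E] := is_derive_coord (i := ord0) i dl.
rewrite [X in _ * X]E.
by case: ifP => _; rewrite ?mulr0// mulrCA mulVf// mulr1.
Qed.

(** The cross terms cancel between the two waves. *)
Lemma wave_gradients phi c x : smooth phi -> c != 0 ->
  dotr (gradient (sin_wave phi c) x) (gradient (sin_wave phi c) x) +
  dotr (gradient (cos_wave phi c) x) (gradient (cos_wave phi c) x) =
  phi x ^+ 2 + (c^-1) ^+ 2 * dotr (gradient phi x) (gradient phi x).
Proof.
move=> sp c0; have [ss sc] := smooth_sin_cos c (@ord0 n).
rewrite /dotr -big_split mulr_sumr /=.
have -> : phi x ^+ 2 = \sum_(i < n.+1) (if ord0 == i then phi x ^+ 2 else 0).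
  by rewrite -big_mkcond (big_pred1 ord0)// => i; rewrite eq_sym.
rewrite -big_split; apply: eq_bigr => i _ /=.
rewrite !gradientE.
rewrite (partial_wave i x sp ss (@is_derive_sin R) c0).
rewrite (partial_wave i x sp sc (@is_derive_cos R) c0).
have := cos2Dsin2 (c * x 0 ord0).
set S := sin _; set C := cos _; set p := partial i phi x => CS.
have {}CS : S ^+ 2 = 1 - C ^+ 2 by lra.
case: ifP => _.
  transitivity ((phi x ^+ 2 + (c^-1) ^+ 2 * p ^+ 2) * (C ^+ 2 + S ^+ 2)); first by ring.
  by rewrite CS; ring.
transitivity ((c^-1) ^+ 2 * p ^+ 2 * (C ^+ 2 + S ^+ 2)); first by ring.
by rewrite CS; ring.
Qed.

(** Oscillating test functions: as [c] tends to infinity the gradients of the two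
    waves of amplitude [phi] carry the energy density [phi ^+ 2]. *)
Lemma energy_bound_to_L2 d K L phi : bounded_coef Omega d K -> 0 <= L ->
  (forall psi, test_function Omega psi ->
    `|energy Omega d (gradient psi) (gradient psi)| <= L * fn (gradient psi) ^+ 2) ->
  test_function Omega phi ->
  `|\int[mu]_(x in Omega) (d x * phi x ^+ 2)| <= L * \int[mu]_(x in Omega) (phi x ^+ 2).
Proof.
move=> dK L0 HL tp; have sp := test_function_smooth tp.
have sg := tfield tp; have [mp jp] := tsqi tp.
have split_int e K' c : bounded_coef Omega e K' -> c != 0 ->
    energy Omega e (gradient (sin_wave phi c)) (gradient (sin_wave phi c)) +
    energy Omega e (gradient (cos_wave phi c)) (gradient (cos_wave phi c)) =
    (c^-1) ^+ 2 * energy Omega e (gradient phi) (gradient phi) +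
    \int[mu]_(x in Omega) (e x * phi x ^+ 2).
  move=> eK c0.
  have s1 := tfield (sin_wave_test c tp); have s2 := tfield (cos_wave_test c tp).
  have j1 : mu.-integrable Omega (EFin \o (fun x => e x * phi x ^+ 2)).
    have := integrable_coef_mul mO eK (tsqi tp) (tsqi tp).
    by under eq_fun do rewrite -expr2.
  rewrite -(RintegralZD mO _ (integrable_energy mO eK sg sg) j1).
  rewrite /energy -RintegralD//; first last.
  - exact: (integrable_energy mO eK s2 s2).
  - exact: (integrable_energy mO eK s1 s1).
  - exact: mO.
  by apply: eq_Rintegral => x _; rewrite -mulrDr wave_gradients//; ring.
set X := `|_|; set Y := L * _.
pose Z := L * fn (gradient phi) ^+ 2 + `|energy Omega d (gradient phi) (gradient phi)|.
have Z0 : 0 <= Z by rewrite addr_ge0// mulr_ge0// sqr_ge0.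
have key k : X <= Y + (2 ^- k) ^+ 2 * Z.
  pose c := 2 ^+ k : R.
  have c0 : c != 0 by rewrite expf_neq0.
  have h1 := HL _ (sin_wave_test c tp); have h2 := HL _ (cos_wave_test c tp).
  have E1 := split_int _ _ c dK c0.
  have E2 := split_int _ _ c (bounded_coef_cst Omega 1) c0.
  rewrite -!(sqr_field_norm mO) in E2; last first.
    exact: tfield (sin_wave_test c tp).
    exact: tfield (cos_wave_test c tp).
    exact: sg.
  have -> : X = `|(energy Omega d (gradient (sin_wave phi c)) (gradient (sin_wave phi c)) +
    energy Omega d (gradient (cos_wave phi c)) (gradient (cos_wave phi c))) -
    (c^-1) ^+ 2 * energy Omega d (gradient phi) (gradient phi)|.
    by rewrite E1 addrAC subrr add0r.
  apply: le_trans (ler_normB _ _) _.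
  apply: le_trans (lerD (ler_normD _ _) (lexx _)) _.
  rewrite normrM (ger0_norm (sqr_ge0 _)).
  have E3 : Y = L * (fn (gradient (sin_wave phi c)) ^+ 2 + fn (gradient (cos_wave phi c)) ^+ 2
      - (c^-1) ^+ 2 * fn (gradient phi) ^+ 2).
    rewrite E2 addrAC subrr add0r; congr (_ * _); apply: eq_Rintegral => x _.
    by rewrite mul1r.
  rewrite E3 /Z.
  exact: add_le_of_le_mul h1 h2.
have : Num.max 0 (X - Y) = 0.
  apply: (@eq0_of_le_cvg0 _ _ Z _ cvg_half_pow) => k.
  rewrite ger0_norm ?le_max ?lexx// ge_max mulr_ge0//=.
  rewrite lerBlDl; apply: le_trans (key k) _; rewrite lerD2l mulrC ler_wpM2l// expr2.
  by rewrite ler_piMr ?invr_ge0 ?exprn_ge0// invf_le1 ?exprn_gt0// exprn_ege1// ler1n.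
by move=> E; rewrite -subr_le0 -E le_max lexx orbT.
Qed.

End oscillation.

(** * Indicators as limits of test functions *)

Section density.
Context {R : realType} {n : nat}.
Variables (Omega : set 'rV[R]_n.+1) (M : R).
Hypothesis oO : open Omega.
Hypothesis OM : Omega `<=` ccube 0 M.
Local Notation mu := (lebesgue_rV n.+1).
Local Notation mO := (bounded_open_measurable oO).
Local Notation Ofin := (bounded_open_lty oO OM).
Local Notation L2 := (square_integrable mu Omega).
Local Notation L2n := (L2norm Omega).
Local Notation tsqi := (test_function_sqi oO OM).
Implicit Types (f g h phi : 'rV[R]_n.+1 -> R) (E : set 'rV[R]_n.+1).

Definition approximable h := L2 h /\
  forall e, 0 < e -> exists2 phi, test_function Omega phi & L2n (h - phi) < e.

Lemma approximable_test phi : test_function Omega phi -> approximable phi.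
Proof.
move=> tp; split => [|e e0]; first exact: tsqi.
exists phi => //; rewrite (_ : L2n _ = 0)//.
rewrite /L2norm (@eq_Rintegral _ _ _ mu Omega (fun=> 0)) ?Rintegral_cst ?mul0r ?sqrtr0//.
  exact: mO.
by move=> x _; rewrite -[(phi - phi) x]/(phi x - phi x) subrr expr0n.
Qed.

Lemma L2n_triangle f g h : L2 f -> L2 g -> L2 h -> L2n (f - h) <= L2n (f - g) + L2n (g - h).
Proof.
move=> sf sg sh; have := L2_norm_lin mO 1 (sqiB mO sf sg) (sqiB mO sg sh).
rewrite normr1 mul1r; apply: le_trans; apply: le_of_eq; congr Num.sqrt.
by apply: eq_Rintegral => x _; congr (_ ^+ 2); rewrite mul1r addrA subrK.
Qed.

Lemma approximable_closed h : L2 h ->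
  (forall e, 0 < e -> exists2 g, approximable g & L2n (h - g) < e) -> approximable h.
Proof.
move=> sh hg; split => // e e0; have e20 : 0 < e / 2 by rewrite divr_gt0.
have [g [sg ga] hge] := hg _ e20; have [phi tp gphi] := ga _ e20.
exists phi => //; apply: le_lt_trans (L2n_triangle sh sg (tsqi tp)) _; lra.
Qed.

Lemma approximableB f g : approximable f -> approximable g -> approximable (f - g).
Proof.
move=> [sf fa] [sg ga]; split => [|e e0]; first exact: (sqiB mO sf sg).
have e20 : 0 < e / 2 by rewrite divr_gt0.
have [phi tp fphi] := fa _ e20; have [psi tq gpsi] := ga _ e20.
have tpq : test_function Omega ((-1) *: psi + phi) by exact: test_function_lin.
exists ((-1) *: psi + phi) => //.
have := L2_norm_lin mO (-1) (sqiB mO sg (tsqi tq)) (sqiB mO sf (tsqi tp)).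
rewrite normrN1 mul1r => h; apply: (@le_lt_trans _ _ (L2n (g - psi) + L2n (f - phi))).
  apply: le_trans h; apply: le_of_eq; congr Num.sqrt; apply: eq_Rintegral => x _; congr (_ ^+ 2).
  rewrite -[LHS]/((f x - g x) - (-1 * psi x + phi x)); ring.
lra.
Qed.

Lemma L2_dominated (f_ : nat -> 'rV[R]_n.+1 -> R) f :
  (forall k, measurable_fun Omega (f_ k)) -> measurable_fun Omega f ->
  (forall k x, 0 <= f_ k x <= 1) -> (forall x, 0 <= f x <= 1) ->
  (forall x, Omega x -> f_ ^~ x @ \oo --> f x) ->
  (fun k => L2n (f - f_ k)) @ \oo --> 0.
Proof.
move=> mf_ mf f_01 f01 cf.
have mB k : measurable_fun Omega (fun x => (f x - f_ k x) ^+ 2).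
  by apply: measurable_funX; exact: measurable_funB.
have jB k : mu.-integrable Omega (EFin \o (fun x => (f x - f_ k x) ^+ 2)).
  have [] // := @sqi_bounded _ _ _ mu Omega mO Ofin (fun x => f x - f_ k x) 1.
    exact: measurable_funB.
  move=> x _; have /andP[? ?] := f_01 k x; have /andP[? ?] := f01 x.
  by rewrite ler_norml; apply/andP; split; lra.
have cI : (fun k => \int[mu]_(x in Omega) ((f x - f_ k x) ^+ 2)%:E)%E @ \oo --> 0%E.
  rewrite -(@integral0 _ _ _ mu Omega).
  apply: (@dominated_cvg _ _ _ mu Omega mO _ _ (fun=> 1%E)) => //.
  - by move=> k; exact/measurable_EFinP.
  - move=> x Ox; apply: cvg_EFin; first exact: nearW.
    rewrite /comp/= -[X in _ --> X](_ : (f x - f x) ^+ 2 = 0); last by rewrite subrr expr0n.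
    apply: (@cvg_comp _ _ _ _ (fun y : R => y ^+ 2)); last exact: exprn_continuous.
    by apply: cvgB; [exact: cvg_cst|exact: cf].
  - have [_] := sqi_cst mO Ofin 1.
    by under eq_fun do rewrite expr1n.
  - move=> k x _ /=; rewrite lee_fin ger0_norm ?sqr_ge0//.
    have /andP[? ?] := f_01 k x; have /andP[? ?] := f01 x.
    by rewrite -[leRHS](expr1n _ 2) -real_normK ?num_real// ler_sqr ?nnegrE// ler_norml;
       apply/andP; split; lra.
have cR : (fun k => \int[mu]_(x in Omega) ((f x - f_ k x) ^+ 2)) @ \oo --> (0 : R).
  apply/cvg0_EFin; rewrite (_ : (fun _ => _) =
    (fun k => \int[mu]_(x in Omega) ((f x - f_ k x) ^+ 2)%:E)%E)//.
  by apply/funext => k; rewrite (EFin_Rintegral mO (jB k)).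
rewrite -[X in _ --> X](@sqrtr0 R).
apply: (@cvg_comp _ _ _ _ (@Num.sqrt R)); last exact: sqrt_continuous.
exact: cR.
Qed.

(** [1 - (1 - g) ^+ k] is a smooth function of [g] that tends to the indicator of
    the set where [g] does not vanish. *)
Lemma approximable_nonzero_set g : test_function Omega g -> (forall x, 0 <= g x <= 1) ->
  approximable (\1_[set x | g x != 0]).
Proof.
move=> tg g01.
pose h k x := 1 + - 1 * (1 + - 1 * g x) ^+ k.
have sh k : smooth (h k).
  apply: smoothD; first exact: smooth_cst.
  apply: smoothM; first exact: smooth_cst.
  apply: smoothX; apply: smoothD; first exact: smooth_cst.
  by apply: smoothM; [exact: smooth_cst|exact: (test_function_smooth tg)].
have th k : test_function Omega (h k).
  apply: (test_function_sub tg) => // x hx; apply: subset_closure => /=.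
  by apply: contraNneq hx => gx; rewrite /h gx mulr0 addr0 expr1n; lra.
have m1 : measurable_fun Omega (\1_[set x | g x != 0] : _ -> R).
  apply: measurable_funTS; apply: measurable_indic.
  have mg := smooth_measurable (test_function_smooth tg).
  rewrite [X in measurable X](_ : _ = ~` (g @^-1` [set 0])).
    by apply: measurableC; rewrite -[X in measurable X]setTI; exact: mg.
  by apply/seteqP; split => x /= /eqP.
have b01 x : 0 <= (\1_[set x | g x != 0] x : R) <= 1.
  by rewrite indicE; case: (_ \in _); rewrite ?ler01 ?lexx.
apply: approximable_closed => [|e e0].
  apply: (sqi_bounded mO Ofin (M := 1)) => // x _.
  by have /andP[? ?] := b01 x; rewrite ger0_norm.
have := @L2_dominated h (\1_[set x | g x != 0]).
have h01 k x : 0 <= h k x <= 1.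
  have /andP[g0 g1] := g01 x; rewrite /h !mulN1r subr_ge0 gerBl exprn_ge0 ?subr_ge0// andbT.
  by apply: exprn_ile1; rewrite ?subr_ge0// gerBl.
have hm k : measurable_fun Omega (h k) by apply: measurable_funTS; exact: smooth_measurable.
move=> /(_ hm m1 h01 b01) H.
have : (fun k => L2n (\1_[set x | g x != 0] - h k)) @ \oo --> 0.
  apply: H => x _; have /andP[g0 g1] := g01 x.
  rewrite indicE; have [gx|gx] := eqVneq (g x) 0.
    rewrite memNset /=; last by rewrite gx eqxx.
    rewrite (_ : h^~ x = fun=> 0); first exact: cvg_cst.
    by apply/funext => k; rewrite /h gx mulr0 addr0 expr1n; lra.
  rewrite mem_set//= -[X in _ --> X](_ : 1 + - 1 * 0 = 1%:R); last by rewrite mulr0 addr0.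
  apply: cvgD; first exact: cvg_cst.
  apply: cvgM; first exact: cvg_cst.
  apply: cvg_expr; rewrite mulN1r ger0_norm ?subr_ge0//.
  by rewrite gtrBl lt_neqAle eq_sym gx.
move=> /cvgrPdist_lt /(_ e e0) [k _ /(_ k (leqnn k))] /=.
rewrite sub0r normrN ger0_norm ?L2norm_ge0// => he.
by exists (h k) => //; exact: approximable_test.
Qed.

Definition cube_bump (c : 'rV[R]_n.+1) r (x : 'rV[R]_n.+1) : R :=
  \prod_i (flat 1 (1 * x 0 i + (r - c 0 i)) * flat 1 (- 1 * x 0 i + (r + c 0 i))).

Lemma smooth_cube_bump c r : smooth (cube_bump c r).
Proof. by apply: smooth_prod => i; apply: smoothM; exact: smooth_flat. Qed.

Lemma cube_bump_neq0 c r x : (cube_bump c r x != 0) <-> cube c r x.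
Proof.
rewrite /cube_bump; split=> [/prodf_neq0 h i|h].
  have := h i isT; rewrite mulf_eq0 negb_or !flat1_neq0 => /andP[h1 h2].
  by rewrite ltr_norml; apply/andP; split; lra.
apply/prodf_neq0 => i _; have := h i; rewrite ltr_norml => /andP[h1 h2].
by rewrite mulf_eq0 negb_or !flat1_neq0; apply/andP; split; lra.
Qed.

Lemma cube_bump01 c r x : 0 <= cube_bump c r x <= 1.
Proof.
apply/andP; split; first by apply: prodr_ge0 => i _; rewrite mulr_ge0// flat1_ge0.
apply: prodr_ile1 => i _; rewrite mulr_ge0 ?flat1_ge0//=.
by rewrite mulr_ile1 ?flat1_ge0 ?flat1_le1.
Qed.

(** Sets where a smooth function with values in [0, 1] does not vanish: they are
    stable under intersection, and generate the Borel sets. *)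
Definition smooth_nonzero_sets : set (set 'rV[R]_n.+1) :=
  [set A | exists g, [/\ smooth g, forall x, 0 <= g x <= 1 & A = [set x | g x != 0]]].

Lemma smooth_nonzero_setsI : setI_closed smooth_nonzero_sets.
Proof.
move=> A B [g [sg g01 ->]] [h [sh h01 ->]]; exists (fun x => g x * h x); split.
- exact: smoothM.
- move=> x; have /andP[? ?] := g01 x; have /andP[? ?] := h01 x.
  by rewrite mulr_ge0//= mulr_ile1.
- apply/seteqP; split => x /=; first by move=> [gx hx]; rewrite mulf_neq0.
  by rewrite mulf_eq0 negb_or => /andP.
Qed.

(** The half-space [x_i > a] is the set where [flat 1 (x_i - a)] does not vanish. *)
Lemma measurable_smooth_nonzero_sets (E : set 'rV[R]_n.+1) : measurable E ->
  <<s smooth_nonzero_sets >> E.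
Proof.
move=> mE.
(* The identity is measurable from the generated sigma-algebra, by coordinates. *)
pose T' := g_sigma_algebraType smooth_nonzero_sets.
have : measurable_fun [set: T'] (idfun : T' -> 'rV[R]_n.+1).
  apply: measurable_fun_rVP => i.
  apply: (measurability _ (RGenOInfty.measurableE R)) => _ [_ [a ->] <-].
  rewrite setTI; apply: sub_sigma_algebra.
  exists (fun x => flat 1 (1 * x 0 i + - a)); split.
  - exact: smooth_flat.
  - by move=> x; rewrite flat1_ge0 flat1_le1.
  - apply/seteqP; split => x /=; rewrite flat1_neq0 mul1r subr_gt0 in_itv/= andbT//.
by move=> /(_ measurableT E mE); rewrite setTI.
Qed.

(** The sets for which the conclusion holds form a lambda-system. They include the sets
    where a smooth [g] does not vanish: the product of [g] with the bump function of
    the cube is a test function. *)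
Lemma approximable_in_cube c r E : ccube c r `<=` Omega -> measurable E ->
  approximable (\1_(E `&` cube c r)).
Proof.
move=> cO mE.
pose H : set (set 'rV[R]_n.+1) := [set A | measurable A /\ approximable (\1_(A `&` cube c r))].
suff : <<s smooth_nonzero_sets >> `<=` H.
  by move=> /(_ E (measurable_smooth_nonzero_sets mE)) [].
have mS A : smooth_nonzero_sets A -> measurable A.
  move=> [g [sg _ ->]]; have mg := smooth_measurable sg.
  rewrite [X in measurable X](_ : _ = ~` (g @^-1` [set 0])).
    by apply: measurableC; rewrite -[X in measurable X]setTI; exact: mg.
  by apply/seteqP; split => x /= /eqP.
have gen A : smooth_nonzero_sets A -> H A.
  move=> GA; split; first exact: mS.
  have [g [sg g01 ->]] := GA.
  have tb : test_function Omega (fun x => g x * cube_bump c r x).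
    apply: test_functionM => //; apply: (test_function_ccube cO).
      exact: smooth_cube_bump.
    by move=> x /cube_bump_neq0; exact: cube_sub_ccube.
  rewrite (_ : _ `&` _ = [set x | g x * cube_bump c r x != 0]).
    apply: approximable_nonzero_set => // x.
    have /andP[? ?] := g01 x; have /andP[? ?] := cube_bump01 c r x.
    by rewrite mulr_ge0//= mulr_ile1.
  apply/seteqP; split => x /=.
    by move=> [gx /cube_bump_neq0 bx]; rewrite mulf_neq0.
  by rewrite mulf_eq0 negb_or => /andP[gx /cube_bump_neq0].
have cm : measurable (cube c r) by exact: measurable_cube.
have lam : lambda_system setT H.
  split.
  - by [].
  - apply: gen; exists (fun=> 1); split; first exact: smooth_cst.
      by move=> x; rewrite ler01 lexx.
    by apply/seteqP; split => // x _ /=; exact: oner_neq0.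
  - move=> A B BA [mA aA] [mB aB]; split; first exact: measurableD.
    rewrite (_ : \1_(_ `&` _) = \1_(A `&` cube c r) - \1_(B `&` cube c r)).
      exact: approximableB.
    apply/funext => x; rewrite -[RHS]/(\1_(A `&` cube c r) x - \1_(B `&` cube c r) x) !indicE.
    rewrite (in_setI _ (A `\` B)) in_setD !in_setI; have := BA x.
    case: (boolP (x \in B)) => [/set_mem Bx /(_ Bx) /mem_set ->|_ _].
      by case: (x \in cube c r); rewrite /= subrr.
    by rewrite andbT /= subr0.
  - move=> F ndF HF; have mF k : measurable (F k) by case: (HF k).
    have mU : measurable (\bigcup_k F k) by exact: bigcup_measurable.
    split => //; apply: approximable_closed => [|e e0].
      apply: (sqi_bounded mO Ofin (M := 1)).
        by apply: measurable_funTS; apply: measurable_indic; exact: measurableI.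
      by move=> x _; rewrite indicE; case: (_ \in _); rewrite ?normr1 ?normr0.
    have b01 A x : 0 <= (\1_A x : R) <= 1.
      by rewrite indicE; case: (_ \in _); rewrite ?ler01 ?lexx.
    have : (fun k => L2n (\1_((\bigcup_k F k) `&` cube c r) - \1_(F k `&` cube c r))) @ \oo --> 0.
      apply: L2_dominated => //.
      + by move=> k; apply: measurable_funTS; apply: measurable_indic; exact: measurableI.
      + by apply: measurable_funTS; apply: measurable_indic; exact: measurableI.
      + move=> x _; rewrite indicE; case: (boolP (x \in _)) => [|xU].
          move=> /set_mem[[k _ Fkx] cx]; apply: cvg_near_cst.
          exists k => // l /= kl; rewrite indicE mem_set//; split => //.
          by move: Fkx; exact/subsetPset/ndF.
        apply: cvg_near_cst; apply: nearW => k; rewrite indicE memNset//.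
        move=> [Fkx cx]; move/negP: xU; apply; apply/mem_set; split => //.
        by exists k.
    move=> /cvgrPdist_lt /(_ e e0) [k _ /(_ k (leqnn k))] /=.
    rewrite sub0r normrN ger0_norm ?L2norm_ge0// => he.
    by exists (\1_(F k `&` cube c r)) => //; case: (HF k).
by apply: lambda_system_subset => //; exact: smooth_nonzero_setsI.
Qed.

End density.

(** * From test functions to an almost everywhere bound *)

Lemma le_of_le_small {R : realFieldType} (X Y Z : R) :
  (forall e, 0 < e -> e <= 1 -> X <= Y + e * Z) -> X <= Y.
Proof.
move=> h; apply/ler_addgt0Pr => e e0.
have Zp : 0 < `|Z| + 1 by rewrite ltr_wpDl.
pose t := Num.min 1 (e / (`|Z| + 1)).
have t0 : 0 < t by rewrite lt_min ltr01 divr_gt0.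
have t1 : t <= 1 by rewrite ge_min lexx.
apply: le_trans (h t t0 t1) _; rewrite lerD2l.
apply: (@le_trans _ _ (t * (`|Z| + 1))).
  by rewrite ler_pM2l// (le_trans (ler_norm Z))// lerDl.
by rewrite -ler_pdivlMr// ge_min lexx orbT.
Qed.

Section pointwise_bound.
Context {R : realType} {n : nat}.
Variables (Omega : set 'rV[R]_n.+1) (M : R).
Hypothesis oO : open Omega.
Hypothesis OM : Omega `<=` ccube 0 M.
Local Notation mu := (lebesgue_rV n.+1).
Local Notation mO := (bounded_open_measurable oO).
Local Notation Ofin := (bounded_open_lty oO OM).
Local Notation L2 := (square_integrable mu Omega).
Local Notation L2n := (L2norm Omega).
Local Notation tsqi := (test_function_sqi oO OM).
Implicit Types (d h phi : 'rV[R]_n.+1 -> R).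

Lemma sqr_L2norm h : L2n h ^+ 2 = \int[mu]_(x in Omega) (h x ^+ 2).
Proof. by rewrite sqr_sqrtr// Rintegral_ge0// => x _; exact: sqr_ge0. Qed.

Lemma sqi_coef_mul d K h : bounded_coef Omega d K -> L2 h ->
  L2 (fun x => d x * h x) /\ L2n (fun x => d x * h x) <= K * L2n h.
Proof.
move=> [md dK] sh; have [mh jh] := sh.
have K0 : 0 <= K := le_trans (normr_ge0 _) (dK 0).
have sKh : L2 (fun x => K * h x).
  have [mz jz] := sqi_cst mO Ofin (0 : R).
  by have := sqiZD mO K sh (conj mz jz); under eq_fun do rewrite addr0.
have sdh : L2 (fun x => d x * h x).
  apply: (sqi_le mO _ sKh) => [|x _]; first exact: measurable_funM.
  by rewrite !normrM (ger0_norm K0) ler_wpM2r.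
split => //; have [_ j1] := sdh.
have n0 : 0 <= K * L2n h by rewrite mulr_ge0// L2norm_ge0.
rewrite -(ler_sqr (L2norm_ge0 _ _) n0) exprMn !sqr_L2norm.
rewrite -(RintegralZl _ mO jh); apply: le_Rintegral => //; first exact: mO.
  by apply: integrable_mulc => //; exact: mO.
move=> x _; rewrite exprMn ler_wpM2r ?sqr_ge0// -[d x ^+ 2]real_normK ?num_real//.
by rewrite ler_sqr ?nnegrE.
Qed.

(** Both sides are continuous for the L2 norm, because [d] is bounded. *)
Lemma quadratic_bound_approximable d K L h : bounded_coef Omega d K -> 0 <= L ->
  (forall phi, test_function Omega phi ->
    `|\int[mu]_(x in Omega) (d x * phi x ^+ 2)| <= L * \int[mu]_(x in Omega) (phi x ^+ 2)) ->
  approximable Omega h ->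
  `|\int[mu]_(x in Omega) (d x * h x ^+ 2)| <= L * \int[mu]_(x in Omega) (h x ^+ 2).
Proof.
move=> dK L0 HL [sh ha].
have K0 : 0 <= K := le_trans (normr_ge0 _) (dK.2 0).
have jd g : L2 g -> mu.-integrable Omega (EFin \o (fun x => d x * g x ^+ 2)).
  move=> sg; have := integrable_coef_mul mO dK sg sg.
  by under eq_fun do rewrite -expr2.
rewrite -sqr_L2norm.
apply: (@le_of_le_small _ _ _ ((L + K) * (2 * L2n h + 1))) => e e0 e1.
have [phi tp he] := ha _ e0; have sp := tsqi tp.
have shp := sqiB mO sh sp; have sph := sqiB mO sp sh.
have symn : L2n (phi - h) = L2n (h - phi).
  congr Num.sqrt; apply: eq_Rintegral => x _.
  by rewrite -[LHS]sqrrN -[LHS]/((- (phi x - h x)) ^+ 2) opprB.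
have n0 := L2norm_ge0 Omega h.
have p0 := L2norm_ge0 Omega phi.
have pe : L2n phi <= L2n h + e.
  have := L2_norm_lin mO 1 sh sph; rewrite normr1 mul1r => H.
  apply: (@le_trans _ _ (L2n h + L2n (phi - h))); last by rewrite lerD2l symn ltW.
  apply: le_trans H; apply: le_of_eq; congr Num.sqrt; apply: eq_Rintegral => x _.
  by congr (_ ^+ 2); ring.
have se : L2n (fun x => h x + phi x) <= 2 * L2n h + e.
  have := L2_norm_lin mO 2 sh sph; rewrite ger0_norm// => H.
  apply: (@le_trans _ _ (2 * L2n h + L2n (phi - h))); last by rewrite lerD2l symn ltW.
  apply: le_trans H; apply: le_of_eq; congr Num.sqrt; apply: eq_Rintegral => x _.
  by congr (_ ^+ 2); ring.
have ss : L2 (fun x => h x + phi x).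
  have := sqiZD mO 1 sh sp; by under eq_fun do rewrite mul1r.
have [sds ds] := sqi_coef_mul dK ss.
have diff : `|\int[mu]_(x in Omega) (d x * h x ^+ 2) - \int[mu]_(x in Omega) (d x * phi x ^+ 2)|
    <= e * (K * (2 * L2n h + 1)).
  rewrite -RintegralB; [|exact: mO|exact: jd|exact: jd].
  rewrite (@eq_Rintegral _ _ _ mu Omega (fun x => (h x - phi x) * (d x * (h x + phi x)))); last first.
    by move=> x _; ring.
  apply: le_trans (cauchy_schwarz mO shp sds) _.
  apply: ler_pM; rewrite ?sqrtr_ge0//; first exact: ltW.
  apply: le_trans ds _; rewrite ler_wpM2l//; apply: le_trans se _.
  by rewrite lerD2l.
have main := HL _ tp; rewrite -sqr_L2norm in main.
have p2 : L2n phi ^+ 2 <= L2n h ^+ 2 + e * (2 * L2n h + 1).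
  apply: (@le_trans _ _ ((L2n h + e) ^+ 2)).
    by rewrite ler_sqr ?nnegrE ?addr_ge0// ltW.
  rewrite sqrrD -addrA lerD2l mulrDr mulr1; apply: lerD.
    by rewrite le_eqVlt; apply/orP; left; apply/eqP; ring.
  by rewrite expr2 ler_piMr// ltW.
apply: (@le_trans _ _ (`|\int[mu]_(x in Omega) (d x * phi x ^+ 2)| + e * (K * (2 * L2n h + 1)))).
  rewrite -lerBlDl; apply: le_trans diff.
  exact: lerB_dist.
apply: (@le_trans _ _ (L * (L2n h ^+ 2 + e * (2 * L2n h + 1)) + e * (K * (2 * L2n h + 1)))).
  by rewrite lerD2r; apply: (le_trans main); rewrite ler_wpM2l.
by rewrite le_eqVlt; apply/orP; left; apply/eqP; ring.
Qed.

(** The hypothesis is used for the indicator [h] of the part of the cube where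
    [d > L]: the integral of [(d - L) * h^2], a nonnegative function, is at most 0. *)
Lemma ae_le_on_cube d K L c r : bounded_coef Omega d K ->
  (forall h, approximable Omega h ->
    \int[mu]_(x in Omega) (d x * h x ^+ 2) <= L * \int[mu]_(x in Omega) (h x ^+ 2)) ->
  ccube c r `<=` Omega -> {ae mu, forall x, cube c r x -> d x <= L}.
Proof.
move=> dK H cO; have [md _] := dK.
pose E := Omega `&` d @^-1` `]L, +oo[.
have mE : measurable E by exact: md mO _ (measurable_itv _).
have ah := approximable_in_cube oO OM cO mE.
set h := \1_(E `&` cube c r) : _ -> R in ah.
have [sh _] := ah; have [mh jh] := sh.
have jd : mu.-integrable Omega (EFin \o (fun x => d x * h x ^+ 2)).
  have := integrable_coef_mul mO dK sh sh.
  by under eq_fun do rewrite -expr2.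
pose g x := d x * h x ^+ 2 - L * h x ^+ 2.
have jL := integrable_mulc mO L jh.
have jg : mu.-integrable Omega (EFin \o g) by have := integrableB mO jd jL.
have g0 x : Omega x -> 0 <= g x.
  move=> Ox; rewrite /g -mulrBl /h indicE; case: (boolP (x \in _)) => [|_].
    move=> /set_mem[[_ /=]]; rewrite in_itv/= andbT => Ld _.
    by rewrite expr1n mulr1 subr_ge0 ltW.
  by rewrite expr0n mulr0.
have mg : measurable_fun Omega (EFin \o g) by exact: measurable_int jg.
have I0 : (\int[mu]_(x in Omega) `|(EFin \o g) x| = 0)%E.
  have -> : (\int[mu]_(x in Omega) `|(EFin \o g) x| = \int[mu]_(x in Omega) (g x)%:E)%E.
    by apply: eq_integral => x /[!inE] Ox; rewrite /= ger0_norm// g0.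
  rewrite -(EFin_Rintegral mO jg); congr EFin; apply/eqP; rewrite eq_le; apply/andP; split.
    rewrite /g RintegralB; [|exact: mO|exact: jd|exact: jL].
    by rewrite (RintegralZl _ mO jh) subr_le0 H.
  exact: Rintegral_ge0.
have /(ae_eq_integral_abs mu mO mg) gae := I0.
apply: filterS gae => x /= gx cx.
have Ox : Omega x by apply: cO; exact: cube_sub_ccube.
rewrite leNgt; apply/negP => Ld.
have [] := gx Ox; rewrite /g /h indicE mem_set; last first.
  by split => //; split => //=; rewrite in_itv/= andbT.
by rewrite expr1n !mulr1 => /eqP; rewrite subr_eq0 => /eqP dL; move: Ld; rewrite dL ltxx.
Qed.

Lemma ae_bound_of_quadratic d K L : bounded_coef Omega d K -> 0 <= L ->
  (forall phi, test_function Omega phi ->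
    `|\int[mu]_(x in Omega) (d x * phi x ^+ 2)| <= L * \int[mu]_(x in Omega) (phi x ^+ 2)) ->
  {ae mu, forall x, Omega x -> `|d x| <= L}.
Proof.
move=> dK L0 HL.
have HA h := quadratic_bound_approximable dK L0 HL (h := h).
have NdK : bounded_coef Omega (fun x => - d x) K.
  by case: dK => md dK; split => [|x]; [exact: measurableT_comp|rewrite normrN].
have cubeae p : rat_ccube p `<=` Omega -> {ae mu, forall x, rat_cube p x -> `|d x| <= L}.
  move=> pO.
  have h1 : {ae mu, forall x, rat_cube p x -> d x <= L}.
    apply: (ae_le_on_cube dK _ pO) => h ah.
    exact: le_trans (ler_norm _) (HA h ah).
  have h2 : {ae mu, forall x, rat_cube p x -> - d x <= L}.
    apply: (ae_le_on_cube NdK _ pO) => h ah.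
    apply: le_trans (HA h ah); rewrite -normrN; apply: le_trans (ler_norm _).
    apply: le_of_eq; rewrite -mulN1r -RintegralZl; last 2 first.
    - exact: mO.
    - have [sh _] := ah; have := integrable_coef_mul mO dK sh sh.
      by under eq_fun do rewrite -expr2.
    by apply: eq_Rintegral => x _; rewrite mulN1r mulNr.
  by apply: filterS2 h1 h2 => x ? ? px; rewrite ler_norml lerNl; apply/andP; split; auto.
(* The rational cubes, enumerated through their codes. *)
pose F k : set 'rV[R]_n.+1 := if unpickle k is Some p then
  if `[< rat_ccube p `<=` Omega >] then [set x | rat_cube p x /\ ~ `|d x| <= L] else set0 else set0.
have negF k : mu.-negligible (F k).
  rewrite /F; case: unpickle => [p|]; last exact: negligible_set0.
  case: ifPn => [/asboolP pO|_]; last exact: negligible_set0.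
  apply: negligibleS (cubeae p pO) => x /= [px dL] h; exact/dL/h.
apply: negligibleS (negligible_bigcup negF) => x /= /not_implyP[Ox dL].
have [p px pO] := open_rat_cube oO Ox.
exists (pickle p) => //; rewrite /F pickleK ifT//; exact/asboolP.
Qed.

End pointwise_bound.

Theorem theorem1p1 (R : realType) (n : nat) (Omega : set 'rV[R]_n)
    (sigma0 sigma1 : R) (sigma sigma' : 'rV[R]_n -> R) :
  (1 <= n)%N -> bounded_domain Omega -> 0 < sigma0 -> sigma0 < sigma1 ->
  admissible Omega sigma0 sigma1 sigma ->
  admissible Omega sigma0 sigma1 sigma' ->
  ((sigma0 ^+ 2)%:E * Hm1_H10_norm Omega
      (fun f => resolvent Omega sigma f - resolvent Omega sigma' f)%R
    <= Lp_norm Omega +oo (fun x => sigma x - sigma' x)%R)%E /\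
  (Lp_norm Omega +oo (fun x => sigma x - sigma' x)%R
    <= (sigma1 ^+ 2)%:E * Hm1_H10_norm Omega
      (fun f => resolvent Omega sigma f - resolvent Omega sigma' f)%R)%E.
Proof.
case: n Omega sigma sigma' => [//|n] Omega sigma sigma' _ [_ oO _ [M0 [_ bM]]] s0 s01 adm adm'.
have s01' := ltW s01.
have [M Mge OM] : exists2 M, 0 <= M & Omega `<=` ccube 0 M.
  exists (Num.max 0 (M0 + 1)); first by rewrite le_max lexx.
  move=> x Ox i; rewrite mxE subr0 (le_trans (coord_le_norm x i))//.
  by apply: bM => //; rewrite lt_max ltrDl ltr01 orbT.
have mO := bounded_open_measurable oO.
have [ms aes] := admissible_clip oO s01' adm.
have [ms' aes'] := admissible_clip oO s01' adm'.
set a := clip sigma0 sigma1 sigma in aes; set b := clip sigma0 sigma1 sigma' in aes'.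
have na : elliptic_coef Omega sigma0 sigma1 a.
  by split; [exact: measurable_clip|move=> x; exact: clip_bounds].
have nb : elliptic_coef Omega sigma0 sigma1 b.
  by split; [exact: measurable_clip|move=> x; exact: clip_bounds].
have Ra f : resolvent Omega sigma f = resolvent Omega a f.
  by rewrite /resolvent (weak_solution_ae oO OM _ ms na.1 aes).
have Rb f : resolvent Omega sigma' f = resolvent Omega b f.
  by rewrite /resolvent (weak_solution_ae oO OM _ ms' nb.1 aes').
have aeE P : {ae lebesgue_rV n.+1, forall x, Omega x -> P (sigma x - sigma' x)} <->
    {ae lebesgue_rV n.+1, forall x, Omega x -> P (a x - b x)}.
  by split; apply: filterS3 aes aes' => x e1 e2 h Ox; have := h Ox; rewrite e1// e2.
have -> : (fun f => resolvent Omega sigma f - resolvent Omega sigma' f) =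
          (fun f => resolvent Omega a f - resolvent Omega b f).
  by apply/funext => f; rewrite Ra Rb.
set N := Hm1_H10_norm _ _; set K := Lp_norm _ _ _.
have K0 : (0 <= K)%E by exact: Lnorm_ge0.
have N0 : (0 <= N)%E.
  have H0 : Hm1 Omega (fun=> 0).
    split=> [c u v _ _|]; first by rewrite mulr0 addr0.
    exists 0 => v _; rewrite normr0 mul0e lexx//.
  apply: (@le_trans _ _ (H10_norm Omega (resolvent Omega a (fun=> 0) - resolvent Omega b (fun=> 0)))).
    exact: Lnorm_ge0.
  apply: ereal_sup_ubound; exists (fun=> 0) => //; split => //.
  by apply: ge_ereal_sup => _ [v _ <-]; rewrite normr0 lee_fin.
split.
  case EK : K => [k| |]; [|by rewrite leey|by move: K0; rewrite EK].
  apply: (resolvent_diff_le oO Mge OM s0 na nb).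
    by rewrite -lee_fin -EK.
  by apply/(aeE (fun t => `|t| <= k)); exact: Lp_normy_ae.
have s1 : 0 < sigma1 by exact: lt_trans s01.
case EN : N => [k| |]; last by move: N0; rewrite EN.
  have k0 : 0 <= k by rewrite -lee_fin -EN.
  have L0 : 0 <= sigma1 ^+ 2 * k by rewrite mulr_ge0// sqr_ge0.
  rewrite -EFinM; apply: ae_Lp_normy => //.
  apply/(aeE (fun t => `|t| <= _)).
  have aK := elliptic_coef_bounded s0 na; have bK := elliptic_coef_bounded s0 nb.
  have dK : bounded_coef Omega (fun x => a x - b x) (sigma1 + sigma1).
    split; first by apply: measurable_funB; [case: na|case: nb].
    by move=> x; rewrite (le_trans (ler_normB _ _))// lerD//; [case: aK|case: bK].
  apply: (ae_bound_of_quadratic oO OM dK L0) => phi tp.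
  apply: (energy_bound_to_L2 oO OM dK L0 _ tp) => psi tq.
  by apply: (energy_diff_le_sqr oO Mge OM s0 s01' na nb tq); rewrite -/N EN.
by rewrite gt0_muley ?leey// lte_fin exprn_gt0.
Qed.
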